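(* Let $p$ be $0$ or a prime. Suppose $A\in\mathrm{sub}\mathcal{S}_p$ and $A$ is with full kernel. Then there is $\mathbf{D}\in\mathcal{S}_p$ and an embedding of $A$ into $\mathbf{D}$ such that (identifying $A$ with its image) $A\le\mathbf{D}$ and $\ker_{|D}=\ker_{|A}$.
   Context: $\mathcal{E}_p$ is the class of structures $\mathbf{D}=(D,\mathrm{ex},R)$ where $D$ is a field of characteristic $0$, $R$ a field of characteristic $p$ and $\mathrm{ex}$ a homomorphism of the additive group of $D$ onto $R^\times$. $\mathrm{sub}\mathcal{E}_p$ is the class of structures $A$ where $A$ is a divisible subgroup (equivalently a $\mathbb{Q}$-subspace) of the additive group of some field of characteristic $0$, with a group homomorphism $\mathrm{ex}_A:A\to R^\times$, $R$ some field of characteristic $p$. The structure on $A$ (and on members of $\mathcal{E}_p$) consists of: addition and multiplication by rational scalars; for each algebraic variety $V$ over $\mathbb{Q}$ irreducible over $\mathbb{Q}$, the relation $(x_1,\dots,x_n)\in V$; for each algebraic variety $W$ defined and irreducible over the prime field of characteristic $p$, the relation $(\mathrm{ex}(x_1),\dots,\mathrm{ex}(x_n))\in W$ (in particular the relation $\mathrm{ex}(x)=\mathrm{ex}(y)$). An embedding is an injective $\mathbb{Q}$-linear map preserving and reflecting these relations. For finite $X$, $\delta(X)=\mathrm{tr.d.}(X)+\mathrm{tr.d.}(\mathrm{ex}(X))-\dim_{\mathbb{Q}}(X)$ (transcendence degrees over prime fields, $\dim_{\mathbb{Q}}$ the dimension of the $\mathbb{Q}$-span), $\delta(X/Y)=\delta(X\cup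 Y)-\delta(Y)$ for finite $Y$; for infinite $A$, $\delta(X/A)\ge k$ means that for every finite $Y\subseteq A$ there is a finite $Y'$, $Y\subseteq Y'\subseteq A$, with $\delta(X/Y')\ge k$. $\mathcal{S}_p$ (resp. $\mathrm{sub}\mathcal{S}_p$) is the class of structures in $\mathcal{E}_p$ (resp. $\mathrm{sub}\mathcal{E}_p$) in which $\delta(X)\ge0$ for all finite $X$. $A\le B$ means $A$ is a substructure of $B$ and $\delta(X/A)\ge0$ for all finite $X\subseteq B$. $\ker_{|A}=\{a\in A:\mathrm{ex}(a)=1\}$. $A$ is with full kernel if $A/\ker_{|A}$ is isomorphic to a subgroup, containing all the torsion points, of the multiplicative group of an algebraically closed field of characteristic $p$. *)

(* Defs.v *)
From HB Require Import structures.
From mathcomp Require Import all_boot all_order all_algebra.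
From mathcomp Require Import boolp.
From mathcomp Require Import mpoly.

Set Implicit Arguments.
Unset Strict Implicit.
Unset Printing Implicit Defensive.

Import GRing.Theory.
Local Open Scope ring_scope.

Definition has_char (p : nat) (L : fieldType) : Prop :=
  if p is 0 then [pchar L] =i pred0 else p \in [pchar L].

(* The case split is needed because 'F_0 is convertible to 'F_2. *)
Definition prime_field (p : nat) : fieldType :=
  if p is 0 then rat : fieldType else 'F_p : fieldType.

(* When has_char p L, this is the unique field morphism prime_field p -> L. *)
Definition prime_emb (p : nat) (L : fieldType) : prime_field p -> L :=
  match p return prime_field p -> L with
  | 0 => fun x : rat => ratr x
  | q.+1 => fun x : 'F_q.+1 => (x : nat)%:R
  end.

Definition prime_eval (p : nat) (L : fieldType) (n : nat) (x : 'I_n -> L)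
    (f : {mpoly (prime_field p)[n]}) : L :=
  mmap (@prime_emb p L) x f.

(* An affine variety over a field k which is irreducible over k is given by its
   vanishing ideal, a prime ideal of k[X_1, ..., X_n]; its points in an
   extension field of k are the common zeros of that ideal. *)
Definition variety_over_prime (p n : nat) : Type :=
  prime_idealr {mpoly (prime_field p)[n]}.

Definition on_variety (p : nat) (L : fieldType) (n : nat)
    (V : variety_over_prime p n) (x : 'I_n -> L) : Prop :=
  forall f : {mpoly (prime_field p)[n]}, f \in V -> prime_eval x f = 0.

Definition alg_indep (p : nat) (L : fieldType) (s : seq L) : Prop :=
  forall f : {mpoly (prime_field p)[size s]},
    prime_eval (fun i => s`_i) f = 0 -> f = 0.

Definition lin_indepQ (K : fieldType) (s : seq K) : Prop :=
  forall c : 'I_(size s) -> rat,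
    \sum_i ratr (c i) * s`_i = 0 -> forall i, c i = 0.

(* The largest size of a subfamily of X satisfying indep.  Finite sets are
   represented by sequences: a family with a repeated member is dependent for
   both notions of independence above, so repetitions in X do not matter. *)
Definition rank_for (T : Type) (indep : seq T -> Prop) (X : seq T) : nat :=
  \max_(m : (size X).-tuple bool | `[< indep (mask m X) >]) size (mask m X).

Definition trdeg (p : nat) (L : fieldType) (X : seq L) : nat :=
  rank_for (@alg_indep p L) X.

Definition dimQ (K : fieldType) (X : seq K) : nat :=
  rank_for (@lin_indepQ K) X.

(* Only the restriction of expo to carrier is meaningful. *)
Record subE (p : nat) := SubE {
  dfield : fieldType;
  dfield_char : has_char 0 dfield;
  rfield : fieldType;
  rfield_char : has_char p rfield;
  carrier : zmodClosed dfield;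
  carrier_div : forall (n : nat) (x : dfield), x \in carrier ->
    exists2 y : dfield, y \in carrier & y *+ n.+1 = x;
  expo : dfield -> rfield;
  expo_neq0 : forall x : dfield, x \in carrier -> expo x != 0;
  expoD : forall x y : dfield, x \in carrier -> y \in carrier ->
    expo (x + y) = expo x * expo y
}.

Definition in_E (p : nat) (D : subE p) : Prop :=
  (forall x : dfield D, x \in carrier D) /\
  (forall r : rfield D, r != 0 -> exists x : dfield D, expo x = r).

Definition delta (p : nat) (A : subE p) (X : seq (dfield A)) : int :=
  (trdeg 0 X)%:Z + (trdeg p (map (@expo p A) X))%:Z - (dimQ X)%:Z.

Definition delta_over (p : nat) (A : subE p) (X Y : seq (dfield A)) : int :=
  delta (X ++ Y) - delta Y.

Definition delta_over_ge (p : nat) (A : subE p) (X : seq (dfield A))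
    (Z : dfield A -> Prop) (k : int) : Prop :=
  forall Y : seq (dfield A), (forall y, y \in Y -> Z y) ->
  exists Y' : seq (dfield A),
    [/\ {subset Y <= Y'}, forall y, y \in Y' -> Z y & k <= delta_over X Y'].

Definition in_subS (p : nat) (A : subE p) : Prop :=
  forall X : seq (dfield A), {subset X <= carrier A} -> 0 <= delta X.

Definition in_S (p : nat) (D : subE p) : Prop := in_E D /\ in_subS D.

Definition in_ker (p : nat) (A : subE p) (x : dfield A) : Prop :=
  x \in carrier A /\ expo x = 1.

(* An isomorphism of A / ker_A with a subgroup of F^* is given by the
   homomorphism h : A -> F^* with kernel ker_A which it induces. *)
Definition full_kernel (p : nat) (A : subE p) : Prop :=
  exists (F : closedFieldType) (h : dfield A -> F),
    [/\ has_char p F,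
        forall x, x \in carrier A -> h x != 0,
        forall x y, x \in carrier A -> y \in carrier A -> h (x + y) = h x * h y,
        forall x, x \in carrier A -> (h x = 1 <-> in_ker x)
      & forall (z : F) (n : nat), z ^+ n.+1 = 1 ->
          exists2 x, x \in carrier A & h x = z].

Definition embedding (p : nat) (A B : subE p) (f : dfield A -> dfield B) : Prop :=
  [/\ [/\ forall x, x \in carrier A -> f x \in carrier B,
          {in carrier A &, injective f},
          {in carrier A &, {morph f : x y / x + y}}
        & forall (q : rat) x, x \in carrier A -> f (ratr q * x) = ratr q * f x],
      forall (n : nat) (V : variety_over_prime 0 n) (x : 'I_n -> dfield A),
        (forall i, x i \in carrier A) ->
        (on_variety V x <-> on_variety V (fun i => f (x i)))
    & forall (n : nat) (W : variety_over_prime p n) (x : 'I_n -> dfield A),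
        (forall i, x i \in carrier A) ->
        (on_variety W (fun i => expo (x i)) <->
         on_variety W (fun i => expo (f (x i))))].

Definition image_of (p : nat) (A B : subE p) (f : dfield A -> dfield B)
    (y : dfield B) : Prop :=
  exists2 x, x \in carrier A & f x = y.

(* f is an embedding and f(A) <= B. *)
Definition strong_embedding (p : nat) (A B : subE p)
    (f : dfield A -> dfield B) : Prop :=
  embedding f /\
  forall X : seq (dfield B), {subset X <= carrier B} ->
    delta_over_ge X (image_of f) 0.

(* ker_B = f(ker_A). *)
Definition same_kernel (p : nat) (A B : subE p)
    (f : dfield A -> dfield B) : Prop :=
  forall y : dfield B, in_ker y <-> exists2 x, in_ker x & f x = y.

(* Main.v *)
From HB Require Import structures.
Require Import Defs.
From mathcomp Require Import all_boot all_order all_algebra.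
From mathcomp Require Import fieldext separable cyclic cyclotomic.
From mathcomp Require Import zify.
From mathcomp Require Import boolp.
From mathcomp Require classical_sets.
From mathcomp Require Import mpoly.

Set Implicit Arguments.
Unset Strict Implicit.
Unset Printing Implicit Defensive.
Import GRing.Theory.

(** The field [K] of the structure to be built must carry a surjective
    homomorphism [ex] onto the nonzero elements of a field [F], extending the
    given one on [A] without enlarging its kernel.  Choosing a value for [ex] at
    a new [d] in [K], or a preimage of a new [c] in [F], costs [1] in the
    [Q]-dimension; the predimension does not drop if the other component of the
    new pair is transcendental over everything used before.  So the proof is a
    free construction, in which every element of one field is matched with a
    fresh transcendental of the other field.

    Both fields are obtained from [term_field].  A [term] names an element
    of [K] and an element of [F], and [Var u] names in each field a
    transcendental reserved for the element which [u] names in the other one.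
    That there are fields with enough independent elements, closed under the
    roots needed, is [big_field]: an ultraproduct-like limit ([limit_field]) of
    rational function fields, and then of splitting fields.

    The homomorphism is found by Zorn's lemma ([complete_graph]) among graphs
    extending that of [A].  Each graph is required to have its domain algebraic
    over the transcendentals reserved for elements of its range, and its range
    algebraic over those reserved for elements of its domain.  Hence the
    transcendental reserved for an element outside the domain is still free, and
    the pair may be added provided that the element itself respects the
    requirement; by induction on terms every element does, so a maximal graph has
    full domain, and dually full range.  Adding a pair together
    with compatible roots ([ext]) adds nothing to the kernel because the range
    contains all the roots of unity: this is what the full kernel provides
    ([torsion_in_image]).

    The predimension inequalities are carried along the construction in the form
    [strong B G], for [B] empty and for [B] the graph of [A]; the first one gives
    that the result is in the class, the second one that [A] is strong in it.
    Each step preserves both by [strong_ext].  Transcendence degree and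
    [Q]-dimension enter only as ranks of two pregeometries ([trdegE], [dimQE]),
    for which a small theory of rank relative to a base is developed first. *)

(** * Rank in a finitary matroid *)

Section Rank.
Variables (T : eqType).

Definition adj (B : T -> Prop) (l : seq T) (x : T) : Prop := B x \/ x \in l.

Record pregeometry (cl : (T -> Prop) -> T -> Prop) : Prop := Pregeometry {
  cl_ext : forall S x, S x -> cl S x;
  cl_mono : forall S S' : T -> Prop, (forall x, S x -> cl S' x) ->
    forall x, cl S x -> cl S' x;
  cl_fin : forall S x, cl S x ->
    exists2 l : seq T, (forall y, y \in l -> S y) & cl (fun y => y \in l) x;
  cl_exch : forall S a x, cl (adj S [:: a]) x -> ~ cl S x -> cl (adj S [:: x]) a
}.

Variable cl : (T -> Prop) -> T -> Prop.

Definition jump (S : T -> Prop) (x : T) : nat := ~~ `[< cl S x >].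

(** Counting the elements that are outside the closure of the base and of the
    later ones makes additivity ([rk_cat]) hold by definition; the price is that
    invariance under permutation has to be derived from exchange. *)
Fixpoint rk (B : T -> Prop) (l : seq T) : nat :=
  if l is a :: l' then jump (adj B l') a + rk B l' else 0.

Hypothesis pcl : pregeometry cl.

Lemma cl_sub (S S' : T -> Prop) : (forall x, S x -> S' x) ->
  forall x, cl S x -> cl S' x.
Proof. by move=> sub; apply: (cl_mono pcl) => x /sub; apply: (cl_ext pcl). Qed.

Lemma cl_eq (S S' : T -> Prop) x : (forall x, S x <-> S' x) -> cl S x = cl S' x.
Proof. by move=> eqS; apply: propext; split; apply: cl_sub => y /eqS. Qed.

Lemma jump_eq (S S' : T -> Prop) x : (forall x, S x <-> S' x) -> jump S x = jump S' x.
Proof. by move=> eqS; rewrite /jump (cl_eq x eqS). Qed.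

Lemma jump_le (S S' : T -> Prop) x : (forall x, S x -> cl S' x) -> jump S' x <= jump S x.
Proof.
move=> sub; rewrite /jump; case: (asboolP (cl S x)) => [/(cl_mono pcl sub)/asboolP -> //|_].
exact: leq_b1.
Qed.

Lemma jump1 (S : T -> Prop) x : ~ cl S x -> jump S x = 1.
Proof. by rewrite /jump => /asboolPn ->. Qed.

Lemma jump0 (S : T -> Prop) x : cl S x -> jump S x = 0.
Proof. by rewrite /jump => /asboolP ->. Qed.

Lemma rk_eq (B B' : T -> Prop) l : (forall x, B x <-> B' x) -> rk B l = rk B' l.
Proof.
move=> eqB; elim: l => //= a l ->; congr addn.
by apply: jump_eq => x; rewrite /adj; have := eqB x; tauto.
Qed.

Lemma rk_cat B l l' : rk B (l ++ l') = (rk B l' + rk (adj B l') l)%N.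
Proof.
elim: l => [|a l IH] /=; first by rewrite addn0.
rewrite IH addnCA; congr addn; congr addn.
apply: jump_eq => x; rewrite /adj mem_cat.
by case: (x \in l); case: (x \in l'); intuition done.
Qed.

(** The only use of exchange; all the invariance properties of the rank follow
    from it. *)
Lemma rk_swap B a b l : rk B [:: a, b & l] = rk B [:: b, a & l].
Proof.
rewrite /= !addnA /jump; congr addn.
have swap (c d : T) : cl (adj B (c :: l)) d <-> cl (adj (adj B l) [:: c]) d.
  rewrite (@cl_eq _ (adj (adj B l) [:: c])) // => x.
  by rewrite /adj !inE; case: (x == c); case: (x \in l); intuition done.
have weak (c d : T) : cl (adj B l) d -> cl (adj (adj B l) [:: c]) d.
  by apply: cl_sub => x; left.
have absorb (c d : T) : cl (adj B l) c -> cl (adj (adj B l) [:: c]) d ->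
    cl (adj B l) d.
  move=> hc; apply: (cl_mono pcl) => x [|]; first exact: (cl_ext pcl).
  by rewrite inE => /eqP ->.
have exch c d := @cl_exch _ pcl (adj B l) c d.
rewrite !(propext (swap _ _)).
have := absorb a b; have := absorb b a; have := weak b a; have := weak a b; have := exch b a; have := exch a b.
by do 4!case: asboolP => ? //=; tauto.
Qed.

Lemma rk_move B a l l' : rk B (a :: l ++ l') = rk B (l ++ a :: l').
Proof.
elim: l => // b l IH; rewrite !cat_cons rk_swap /= in IH *; rewrite IH.
congr addn; apply: jump_eq => x.
by rewrite /adj inE !mem_cat inE orbCA.
Qed.

Lemma rk_catC B l l' : rk B (l ++ l') = rk B (l' ++ l).
Proof.
elim: l => [|a l IH]; first by rewrite cats0.
rewrite -rk_move cat_cons /= IH; congr addn.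
by apply: jump_eq => x; rewrite /adj !mem_cat orbC.
Qed.

Lemma rk_base_le (B B' : T -> Prop) l : (forall x, B x -> cl B' x) ->
  (rk B' l <= rk B l)%N.
Proof.
move=> sub; elim: l => //= a l IH; rewrite leq_add //; apply: jump_le => x.
case=> [/sub|xl]; last by apply: (cl_ext pcl); right.
by apply: cl_sub => y; left.
Qed.

Lemma rk_eq0 (B : T -> Prop) l : (forall x, x \in l -> cl B x) -> rk B l = 0.
Proof.
elim: l => //= a l IH h; rewrite IH; last by move=> x xl; apply: h; rewrite inE xl orbT.
rewrite jump0 //; apply: (@cl_sub B); first by move=> ?; left.
by apply: h; rewrite mem_head.
Qed.

(** Both sides are compared with the rank of [l ++ l'], computed in two orders:
    over [l'] the list [l] contributes nothing. *)
Lemma rk_le (B : T -> Prop) l l' : (forall x, x \in l -> cl (adj B l') x) ->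
  (rk B l <= rk B l')%N.
Proof.
move=> h; rewrite -[X in (_ <= X)%N]addn0 -(rk_eq0 h) -rk_cat rk_catC rk_cat.
exact: leq_addr.
Qed.

Lemma rk_size B l : (rk B l <= size l)%N.
Proof. by elim: l => //= a l IH; rewrite -add1n leq_add // leq_b1. Qed.

(** Finite character: each of the finitely many dependences used by the rank
    involves finitely many elements of the base. *)
Lemma rk_fin (B : T -> Prop) l : exists2 Y : seq T, (forall y, y \in Y -> B y) &
  (rk (fun y => y \in Y) l <= rk B l)%N.
Proof.
elim: l => [|a l [Y YB le]]; first by exists [::].
have [h|h] := EM (cl (adj B l) a); last first.
  by exists Y => //=; rewrite leq_add // [X in (_ <= X)%N]jump1 // leq_b1.
have [Z ZB hZ] := cl_fin pcl h.
have [Z' Z'B subZ] : exists2 Z' : seq T, (forall y, y \in Z' -> B y) &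
    forall y, y \in Z -> y \in Z' \/ y \in l.
  exists [seq y <- Z | y \notin l] => y.
    by rewrite mem_filter => /andP[yl /ZB[]//]; rewrite (negbTE yl).
  by move=> yZ; rewrite mem_filter yZ andbT; case: (y \in l); [right | left].
exists (Z' ++ Y) => [y|]; first by rewrite mem_cat => /orP[/Z'B|/YB].
rewrite /= leq_add //; last first.
  apply: leq_trans le; apply: rk_base_le => y yY.
  by apply: (cl_ext pcl); rewrite mem_cat yY orbT.
rewrite jump0 //; apply: cl_sub hZ => y /subZ[yZ|]; last by right.
by left; rewrite mem_cat yZ.
Qed.

Lemma rk_mask m B l : (rk B (mask m l) <= rk B l)%N.
Proof. by apply: rk_le => x /mem_mask xl; apply: (cl_ext pcl); right. Qed.

(** A maximal free subfamily is extracted by discarding the elements that lie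
    in the closure of the later ones. *)
Lemma rk_basis B l : exists2 m : bitseq, size m = size l &
  rk B (mask m l) = rk B l /\ size (mask m l) = rk B l.
Proof.
elim: l => [|a l [m sm [rm zm]]]; first by exists [::].
have [h|h] := EM (cl (adj B l) a).
  by exists (false :: m); rewrite /= ?sm // jump0.
exists (true :: m); rewrite /= ?sm // zm rm !jump1 // => h'; case: h.
by apply: cl_sub h' => x [|/mem_mask]; [left | right].
Qed.

(** Bridge to ranks given as the largest size of an independent subfamily. *)
Lemma rank_forE (indep : seq T -> Prop) :
  (forall s, indep s <-> rk (fun=> False) s = size s) ->
  forall l, rank_for indep l = rk (fun=> False) l.
Proof.
move=> indepP l; apply/eqP; rewrite eqn_leq; apply/andP; split.
  by apply/bigmax_leqP => m /asboolP/indepP <-; apply: rk_mask.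
have [m sm [rm zm]] := rk_basis (fun=> False) l.
have sm' : size m == size l by rewrite sm.
rewrite -zm; apply: (@leq_bigmax_cond _ _ (fun m : (size l).-tuple bool => size (mask m l)) (Tuple sm')).
by apply/asboolP/indepP; rewrite /= rm zm.
Qed.

Lemma rk_free_cons B a l : rk B (a :: l) = (size l).+1 <->
  rk B l = size l /\ ~ cl (adj B l) a.
Proof.
have /= le := rk_size B l; split=> [|[-> h]]; last by rewrite jump1.
have [h|h] := EM (cl (adj B l) a); last by rewrite jump1 // add1n => -[].
by rewrite jump0 // add0n => E; rewrite E ltnn in le.
Qed.

End Rank.

(** * Subfields and algebraic closure inside a field *)

Section Subfield.
Local Open Scope ring_scope.
Variables (L : fieldType).

Record subfield_axiom (S : L -> Prop) : Prop := SubfieldAxiom {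
  sf1 : S 1;
  sfB : forall x y, S x -> S y -> S (x - y);
  sf_div : forall x y, S x -> S y -> S (x / y)
}.

(** Bundling a predicate with its closure proof lets the type of its elements
    carry a canonical field structure. *)
Record subfield_set := SubfieldSet {
  sf_pred :> L -> Prop;
  sf_axiom : subfield_axiom sf_pred
}.

Lemma sf0 S : subfield_axiom S -> S 0.
Proof. by case=> S1 SB _; rewrite -(subrr 1); apply: SB. Qed.

Lemma sfN S x : subfield_axiom S -> S x -> S (- x).
Proof. by move=> sS Sx; rewrite -sub0r; apply: sfB => //; apply: sf0. Qed.

Lemma sfD S x y : subfield_axiom S -> S x -> S y -> S (x + y).
Proof. by move=> sS Sx Sy; rewrite -[y]opprK; apply: sfB => //; apply: sfN. Qed.

Lemma sfV S x : subfield_axiom S -> S x -> S x^-1.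
Proof. by move=> sS Sx; rewrite -div1r; apply: sf_div => //; apply: sf1. Qed.

Lemma sfM S x y : subfield_axiom S -> S x -> S y -> S (x * y).
Proof. by move=> sS Sx Sy; rewrite -[y]invrK; apply: sf_div => //; apply: sfV. Qed.

Lemma sfX S x n : subfield_axiom S -> S x -> S (x ^+ n).
Proof.
by move=> sS Sx; elim: n => [|n IH]; [exact: sf1 | rewrite exprS; apply: sfM].
Qed.

Lemma sf_sum S (I : Type) (r : seq I) (F : I -> L) : subfield_axiom S ->
  (forall i, S (F i)) -> S (\sum_(i <- r) F i).
Proof. by move=> sS SF; apply: big_ind => // *; [apply: sf0 | apply: sfD]. Qed.

Lemma sf_horner S (p : {poly L}) x : subfield_axiom S ->
  (forall i, S p`_i) -> S x -> S p.[x].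
Proof.
move=> sS Sp Sx; rewrite horner_coef; apply: sf_sum => // i.
by apply: sfM => //; apply: sfX.
Qed.

Definition sf_mem (S : subfield_set) : {pred L} := fun x => `[< S x >].

Lemma sf_memE S x : (x \in sf_mem S) = `[< S x >]. Proof. by []. Qed.

Lemma sf_mem_closed S : divring_closed (sf_mem S).
Proof.
have sS := sf_axiom S; split=> [|x y /asboolP Sx /asboolP Sy|x y /asboolP Sx /asboolP Sy].
- by apply/asboolP; apply: (sf1 sS).
- by apply/asboolP; apply: (sfB sS).
- by apply/asboolP; apply: (sf_div sS).
Qed.

HB.instance Definition _ S :=
  GRing.isDivringClosed.Build L (sf_mem S) (sf_mem_closed S).

Record subfield (S : subfield_set) :=
  Subfield { subfield_val : L; _ : subfield_val \in sf_mem S }.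

HB.instance Definition _ S := [isSub for @subfield_val S].
HB.instance Definition _ S := [Choice of subfield S by <:].
HB.instance Definition _ S := [SubChoice_isSubIntegralDomain of subfield S by <:].
HB.instance Definition _ S := [SubIntegralDomain_isSubField of subfield S by <:].

Lemma subfieldP S (x : subfield S) : S (val x).
Proof. by have := valP x; rewrite sf_memE => /asboolP. Qed.

Lemma subfield_onto (S : subfield_set) y : S y -> exists x : subfield S, val x = y.
Proof.
by move=> Sy; have yS : y \in sf_mem S by [apply/asboolP]; exists (Subfield yS).
Qed.

End Subfield.

Section AlgebraicClosure.
Local Open Scope ring_scope.

Definition alg_closed_in (L : fieldType) (S : L -> Prop) : Prop :=
  subfield_axiom S /\
  forall (p : {poly L}) x, p != 0 -> (forall i, S p`_i) -> root p x -> S x.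

(** Impredicatively, the smallest relatively algebraically closed subfield
    containing [S]: monotonicity, idempotence and finite character are then
    immediate, and explicit equations are only needed for exchange. *)
Definition alg_cl (L : fieldType) (S : L -> Prop) (x : L) : Prop :=
  forall M, alg_closed_in M -> (forall y, S y -> M y) -> M x.

(** The nonvanishing is that of the image of [G]: [psi] need not be
    injective. *)
Definition alg_over_image (L : fieldType) (E : comNzRingType) (psi : {rmorphism E -> L}) (x : L) :=
  exists2 G : {poly E}, map_poly psi G != 0 & root (map_poly psi G) x.

Section Image.
Variables (L : fieldType) (E : comNzRingType) (psi : {rmorphism E -> L}).

Definition frac_of_image (x : L) := exists P Q : E, psi Q != 0 /\ x = psi P / psi Q.

Lemma frac_of_image_subfield : subfield_axiom frac_of_image.
Proof.
split; first by exists 1, 1; rewrite rmorph1 oner_eq0 divr1.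
  move=> _ _ [P [Q [Q0 ->]]] [P' [Q' [Q'0 ->]]].
  exists (P * Q' - P' * Q), (Q * Q'); rewrite !rmorphB !rmorphM mulf_neq0 //.
  by split=> //; rewrite mulrBl -mulf_div divff // mulr1 [psi Q * _]mulrC -mulf_div divff // mulr1.
move=> _ _ [P [Q [Q0 ->]]] [P' [Q' [Q'0 ->]]].
have [z|nz] := eqVneq (psi P') 0.
  by exists 0, 1; rewrite rmorph1 rmorph0 oner_eq0 z !mul0r invr0 mulr0.
exists (P * Q'), (Q * P'); rewrite !rmorphM mulf_neq0 //.
by split=> //; rewrite invf_div mulf_div.
Qed.

Let N := SubfieldSet frac_of_image_subfield.

Lemma common_denominator (c : nat -> L) n : (forall i, frac_of_image (c i)) ->
  exists2 Q : E, psi Q != 0 & forall i, (i < n)%N -> exists P, psi Q * c i = psi P.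
Proof.
move=> fc; elim: n => [|n [Q Q0 hQ]]; first by exists 1; rewrite ?rmorph1 ?oner_eq0.
have [P [Q' [Q'0 def]]] := fc n.
exists (Q * Q'); first by rewrite rmorphM mulf_neq0.
move=> i; rewrite ltnS leq_eqVlt => /orP[/eqP ->|/hQ[P1 E1]].
  by exists (Q * P); rewrite !rmorphM def -mulrA [psi Q' * _]mulrC divfK.
by exists (Q' * P1); rewrite !rmorphM -E1 mulrCA mulrA.
Qed.

(** Clearing denominators: being algebraic over the ring [psi E] is being
    algebraic over its field of fractions inside [L]. *)
Lemma alg_over_imageP x :
  alg_over_image psi x <-> algebraicOver (val : subfield N -> L) x.
Proof.
split=> [[G G0 rG]|[p p0 rp]].
  have toN e : exists y : subfield N, val y = psi e.
    by apply: subfield_onto; exists e, 1; rewrite rmorph1 oner_eq0 divr1.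
  have [f fE] := choice toN.
  have mapE : map_poly (val : subfield N -> L) (map_poly f G) = map_poly psi G.
    apply/polyP => i; rewrite coef_map /=.
    have f0 : f 0 = 0 by apply: val_inj; rewrite fE !rmorph0.
    by rewrite (coef_map_id0 _ _ f0) fE coef_map.
  exists (map_poly f G); last by rewrite mapE.
  by apply: contraNneq G0 => E0; rewrite -mapE E0 rmorph0.
have [Q Q0 hQ] := @common_denominator (fun i => val p`_i) (size p)
  (fun i => subfieldP p`_i).
have {}hQ i : exists P, psi Q * val p`_i = psi P.
  have [lt|le] := ltnP i (size p); first exact: hQ.
  by exists 0; rewrite nth_default // !rmorph0 mulr0.
have [f fE] := choice hQ.
have E1 : map_poly psi (\poly_(i < size p) f i) = psi Q *: map_poly val p.
  apply/polyP => i; rewrite coef_map coef_poly coefZ coef_map fE.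
  by case: ltnP => // le; rewrite -fE (nth_default _ le) [val 0]rmorph0 mulr0; exact: rmorph0.
exists (\poly_(i < size p) f i); rewrite E1.
  by rewrite scaler_eq0 (negbTE Q0) map_poly_eq0.
by rewrite rootZ.
Qed.

(** The explicit upper bound for [alg_cl]: whatever lies in the closure of
    elements of [psi E] satisfies an equation with coefficients in [psi E].  For
    [E] a polynomial ring this gives exchange and the comparison with algebraic
    independence. *)
Lemma alg_over_image_closed : alg_closed_in (alg_over_image psi).
Proof.
split; first split.
- by apply/alg_over_imageP; apply: algebraic1.
- by move=> x y /alg_over_imageP ax /alg_over_imageP ay; apply/alg_over_imageP/algebraic_sub.
- by move=> x y /alg_over_imageP ax /alg_over_imageP ay; apply/alg_over_imageP/algebraic_div.
move=> p x p0 ap rp; apply/alg_over_imageP/integral_algebraic.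
apply: (integral_root p0 rp); apply/integral_poly => i.
exact/integral_algebraic/alg_over_imageP.
Qed.

Lemma alg_over_image_id e : alg_over_image psi (psi e).
Proof.
exists ('X - e%:P); rewrite rmorphB /= map_polyX map_polyC /=.
  by rewrite polyXsubC_eq0.
by rewrite root_XsubC.
Qed.

Lemma alg_over_image_cl x (M : L -> Prop) : alg_closed_in M -> (forall e, M (psi e)) ->
  alg_over_image psi x -> M x.
Proof.
move=> [sM aM] Mpsi [G G0 rG]; apply: (aM _ x G0 _ rG) => i; rewrite coef_map; exact: Mpsi.
Qed.

End Image.
End AlgebraicClosure.

Section AlgClosure.
Local Open Scope ring_scope.
Variable L : fieldType.
Implicit Types (S : L -> Prop) (x a : L).

Lemma alg_cl_ext S x : S x -> alg_cl S x.
Proof. by move=> Sx M _; apply. Qed.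

Lemma alg_cl_mono S (S' : L -> Prop) : (forall x, S x -> alg_cl S' x) ->
  forall x, alg_cl S x -> alg_cl S' x.
Proof. by move=> h x Sx M cM S'M; apply: (Sx M cM) => y /h; apply. Qed.

Lemma alg_cl_closed S : alg_closed_in (alg_cl S).
Proof.
split; first split.
- by move=> M [sM _] _; apply: sf1.
- by move=> x y cx cy M cM SM; apply: (sfB (proj1 cM)); [apply: cx | apply: cy].
- by move=> x y cx cy M cM SM; apply: (sf_div (proj1 cM)); [apply: cx | apply: cy].
by move=> p x p0 cp rp M cM SM; apply: (proj2 cM p x) => // i; apply: cp.
Qed.

Lemma alg_cl_subfield S : subfield_axiom (alg_cl S).
Proof. by have [] := alg_cl_closed S. Qed.

Lemma finite_list_of (S : L -> Prop) (P : L -> seq L -> Prop) :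
  (forall x l l', {subset l <= l'} -> P x l -> P x l') ->
  forall c : nat -> L,
  (forall i, exists2 l : seq L, (forall y, y \in l -> S y) & P (c i) l) ->
  forall n, exists2 l : seq L, (forall y, y \in l -> S y) &
    forall i, (i < n)%N -> P (c i) l.
Proof.
move=> mono c hc; elim=> [|n [l lS hl]]; first by exists [::].
have [l' l'S hl'] := hc n; exists (l ++ l') => [y|i].
  by rewrite mem_cat => /orP[/lS|/l'S].
rewrite ltnS leq_eqVlt => /orP[/eqP ->|/hl]; last first.
  by apply: mono => y; rewrite mem_cat => ->.
by apply: mono hl' => y; rewrite mem_cat orbC => ->.
Qed.

Lemma alg_cl_fin S x : alg_cl S x ->
  exists2 l : seq L, (forall y, y \in l -> S y) & alg_cl (fun y => y \in l) x.
Proof.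
pose P x (l : seq L) := alg_cl (fun y => y \in l) x.
have mono y (l l' : seq L) : {subset l <= l'} -> P y l -> P y l'.
  by move=> ll'; apply: alg_cl_mono => z zl; apply: alg_cl_ext; apply: ll'.
pose Q y := exists2 l : seq L, (forall y, y \in l -> S y) & P y l.
move/(_ Q); apply; last by move=> y Sy; exists [:: y] => [z|]; [rewrite inE => /eqP -> |
  apply: alg_cl_ext; rewrite mem_head].
have two (op : L -> L -> L) : (forall l y z, P y l -> P z l -> P (op y z) l) ->
    forall y z, Q y -> Q z -> Q (op y z).
  move=> hop y z [l lS hl] [l' l'S hl']; exists (l ++ l').
    by move=> w; rewrite mem_cat => /orP[/lS|/l'S].
  by apply: hop; [apply: mono hl | apply: mono hl'] => w; rewrite mem_cat => ->; rewrite ?orbT.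
split; first split.
- by exists [::] => //; apply: sf1; apply: alg_cl_subfield.
- by apply: two => l y z; apply: sfB; apply: alg_cl_subfield.
- by apply: two => l y z; apply: sf_div; apply: alg_cl_subfield.
move=> p y p0 hp rp; have [l lS hl] := finite_list_of mono hp (size p).
exists l => //; apply: (proj2 (alg_cl_closed (fun z => z \in l)) p y p0 _ rp) => i.
have [lt|le] := ltnP i (size p); first exact: hl.
by rewrite (nth_default _ le); apply: (sf0 (alg_cl_subfield _)).
Qed.

(** With [M] the closure of [S], an equation for [x] over [M[a]] is a polynomial
    in two variables over [M]; read as a polynomial in the other variable it is
    an equation for [a] over [M[x]], nonzero because [x] is transcendental over
    [M]. *)
Lemma alg_cl_exch S a x :
  alg_cl (adj S [:: a]) x -> ~ alg_cl S x -> alg_cl (adj S [:: x]) a.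
Proof.
move=> clx nx; pose M := SubfieldSet (alg_cl_subfield S).
pose ev (b : L) : {rmorphism {poly subfield M} -> L} :=
  horner_eval b \o map_poly (val : subfield M -> L).
have evE b P : ev b P = (map_poly (val : subfield M -> L) P).[b] by [].
have [|y|G G0 rG] := clx (alg_over_image (ev a)).
- exact: alg_over_image_closed.
- case=> [Sy|]; last first.
    rewrite inE => /eqP ->; have := alg_over_image_id (ev a) 'X.
    by rewrite evE map_polyX hornerX.
  have [|y' y'E] := @subfield_onto _ M y; first exact: alg_cl_ext.
  have := alg_over_image_id (ev a) y'%:P.
  by rewrite evE map_polyC hornerC /= y'E.
pose H := map_poly (ev x) (swapXY G).
have cM : subfield_axiom (alg_cl (adj S [:: x])) by apply: alg_cl_subfield.
have evx P : alg_cl (adj S [:: x]) (ev x P).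
  rewrite evE; apply: (sf_horner cM) => [i|]; last first.
    by apply: alg_cl_ext; right; rewrite mem_head.
  rewrite coef_map; apply: alg_cl_mono (subfieldP P`_i) => y Sy.
  by apply: alg_cl_ext; left.
apply: (proj2 (alg_cl_closed (adj S [:: x])) H); last 1 first.
- rewrite /root; have -> : H.[a] = (map_poly (ev a) G).[x]; last exact: rG.
  pose GL := map_poly (map_poly (val : subfield M -> L)) G.
  have hE (b c : L) (Q : {poly {poly subfield M}}) :
      (map_poly (ev b) Q).[c] =
      (map_poly (map_poly (val : subfield M -> L)) Q).[c%:P].[b].
    rewrite (map_poly_comp (horner_eval b)) -[X in _.[X]](hornerC c b).
    by rewrite -[X in _.[X]]/(horner_eval b c%:P) horner_map.
  rewrite !hE; have -> : map_poly (map_poly (val : subfield M -> L)) (swapXY G)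
      = swapXY GL by rewrite /GL swapXY_map.
  exact: horner2_swapXY.
- apply: contraNneq G0 => H0; apply/eqP; rewrite -[G]swapXYK.
  suff -> : swapXY G = 0 by rewrite !rmorph0.
  apply/polyP => i; rewrite coef0; apply: contrapT => nz; apply: nx.
  apply: (proj2 (alg_cl_closed S) (map_poly (val : subfield M -> L) (swapXY G)`_i)); last 1 first.
  + by rewrite /root -evE -coef_map -/H H0 coef0.
  + by rewrite map_poly_eq0; apply/eqP.
  + by move=> j; rewrite coef_map; apply: (@subfieldP _ M).
by move=> i; rewrite coef_map; apply: evx.
Qed.

Lemma alg_cl_pregeometry : pregeometry (@alg_cl L).
Proof.
split; [exact: alg_cl_ext | move=> ???; exact: alg_cl_mono | exact: alg_cl_fin | exact: alg_cl_exch].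
Qed.

Lemma alg_cl_root S x n : alg_cl S (x ^+ n.+1) -> alg_cl S x.
Proof.
move=> Sx; have [sf cl] := alg_cl_closed S; apply: (cl ('X^(n.+1) - (x ^+ n.+1)%:P) x).
- exact: (monic_neq0 (monicXnsubC (x ^+ n.+1) (ltn0Sn n))).
- move=> i; rewrite coefB coefXn coefC; apply: (sfB sf).
    by case: eqP => _; [exact: sf1 | exact: sf0].
  by case: eqP => // _; exact: sf0.
by rewrite /root !hornerE subrr.
Qed.

End AlgClosure.

(** * Algebraic independence as freeness for algebraic closure *)

Section MpolyIndep.
Local Open Scope ring_scope.

Lemma mpoly_ext n (k : comNzRingType) (S : comNzRingType)
    (th1 th2 : {rmorphism {mpoly k[n]} -> S}) :
  (forall c, th1 c%:MP = th2 c%:MP) -> (forall i, th1 'X_i = th2 'X_i) ->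
  th1 =1 th2.
Proof.
move=> hC hX p; rewrite [p]mpolyE !rmorph_sum; apply: eq_bigr => m _.
rewrite -mul_mpolyC !rmorphM hC /= mpolyXE_id; congr (_ * _).
by rewrite !rmorph_prod; apply: eq_bigr => i _; rewrite !rmorphXn hX.
Qed.

Section Uni.
Variables (k : comNzRingType) (n : nat).

(** The first variable is singled out, rather than the last one, so as to follow
    the recursion on lists. *)
Definition split_head : {mpoly k[n.+1]} -> {poly {mpoly k[n]}} :=
  mmap (polyC \o @mpolyC n k)
    (fun i => if unlift ord0 i is Some j then ('X_j)%:P else 'X).

Definition widen_tail : {mpoly k[n]} -> {mpoly k[n.+1]} :=
  mmap (@mpolyC n.+1 k) (fun j => 'X_(lift ord0 j)).

Definition join_head : {poly {mpoly k[n]}} -> {mpoly k[n.+1]} :=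
  horner_eval 'X_ord0 \o map_poly widen_tail.

HB.instance Definition _ := GRing.RMorphism.on split_head.
HB.instance Definition _ := GRing.RMorphism.on widen_tail.
HB.instance Definition _ := GRing.RMorphism.on join_head.

Lemma split_headC c : split_head c%:MP = c%:MP%:P.
Proof. exact: mmapC. Qed.
Lemma split_headX0 : split_head 'X_ord0 = 'X.
Proof. by rewrite /split_head mmapX mmap1U unlift_none. Qed.
Lemma split_headXS j : split_head 'X_(lift ord0 j) = ('X_j)%:P.
Proof. by rewrite /split_head mmapX mmap1U liftK. Qed.
Lemma widen_tailC c : widen_tail c%:MP = c%:MP.
Proof. exact: mmapC. Qed.
Lemma widen_tailX j : widen_tail 'X_j = 'X_(lift ord0 j).
Proof. by rewrite /widen_tail mmapX mmap1U. Qed.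
Lemma join_headE G : join_head G = (map_poly widen_tail G).['X_ord0].
Proof. by []. Qed.

Lemma split_headK : cancel split_head join_head.
Proof.
apply: (@mpoly_ext _ _ _ (join_head \o split_head) idfun) => [c|i] /=.
  by rewrite split_headC join_headE map_polyC hornerC /= widen_tailC.
have [j ->|->] := unliftP ord0 i.
  by rewrite split_headXS join_headE map_polyC hornerC /= widen_tailX.
by rewrite split_headX0 join_headE map_polyX hornerX.
Qed.

Lemma join_headK : cancel join_head split_head.
Proof.
move=> G; rewrite join_headE -horner_map -map_poly_comp /= split_headX0.
rewrite -[RHS]comp_polyXr; congr _.['X]; apply: eq_map_poly.
apply: (@mpoly_ext _ _ _ (split_head \o widen_tail) polyC) => [c|i] /=.
  by rewrite widen_tailC split_headC.
by rewrite widen_tailX split_headXS.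
Qed.

End Uni.

Variables (k L : fieldType) (phi : {rmorphism k -> L}).

Definition free_over (s : seq L) : Prop :=
  forall f : {mpoly k[size s]}, mmap phi (fun i => s`_i) f = 0 -> f = 0.

Let base (x : L) : Prop := exists c, phi c = x.

Lemma alg_cl_range (s : seq L) x :
  alg_cl (adj base s) x <->
  alg_over_image (mmap phi (fun i : 'I_(size s) => s`_i)) x.
Proof.
set psi := mmap _ _; split=> [cx|].
  apply: cx; first exact: alg_over_image_closed.
  move=> y [[c <-]|/(nthP 0)[i lt <-]].
    by have := alg_over_image_id psi c%:MP; rewrite /= /psi mmapC.
  have := alg_over_image_id psi 'X_(Ordinal lt).
  by rewrite /= /psi mmapX mmap1U.
apply: alg_over_image_cl; first exact: alg_cl_closed.
have sf := alg_cl_subfield (adj base s).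
move=> e; rewrite /= /psi /mmap; apply: (sf_sum _ sf) => m.
apply: (sfM sf); first by apply: alg_cl_ext; left; exists (e@_m).
apply: (big_ind _ (sf1 sf)); first by move=> *; apply: (sfM sf).
move=> i _; apply: (sfX _ sf); apply: alg_cl_ext; right.
by apply: mem_nth.
Qed.

Lemma mmap_join_head (a : L) l G :
  mmap phi (fun i => (a :: l)`_i) (join_head G) =
  (map_poly (mmap phi (fun i : 'I_(size l) => l`_i)) G).[a].
Proof.
rewrite join_headE -horner_map -map_poly_comp /= mmapX mmap1U.
congr _.[a]; apply: eq_map_poly.
apply: (@mpoly_ext _ _ _ (mmap phi (fun i : 'I_(size l).+1 => (a :: l)`_i) \o @widen_tail k (size l))
  (mmap phi (fun i : 'I_(size l) => l`_i))) => [c|i] /=.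
  by rewrite widen_tailC !mmapC.
by rewrite widen_tailX !mmapX !mmap1U lift0.
Qed.

(** An equation for [a] over the ring generated by [l] and a polynomial relation
    between [a] and [l] are the same thing, up to the isomorphism between
    polynomials in [n + 1] variables and polynomials over polynomials in [n]
    variables. *)
Lemma free_over_cons a l :
  free_over (a :: l) <-> free_over l /\ ~ alg_cl (adj base l) a.
Proof.
split=> [free|[free na] f f0].
  split=> [f f0|/alg_cl_range[G G0 rG]].
    have E : join_head f%:P = 0.
      by apply: free; rewrite mmap_join_head map_polyC hornerC.
    by apply/eqP; rewrite -polyC_eq0 -[f%:P]join_headK E rmorph0.
  have E : join_head G = 0 by apply: free; rewrite mmap_join_head; apply/eqP.
  by move: G0; rewrite -[G]join_headK E !rmorph0 eqxx.
rewrite -[f]split_headK in f0 *; rewrite mmap_join_head in f0.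
suff -> : split_head f = 0 by rewrite rmorph0.
apply/polyP => i; rewrite coef0; apply: free; rewrite -coef_map.
have [-> |nz] := eqVneq (map_poly (mmap phi (fun i : 'I_(size l) => l`_i)) (split_head f)) 0.
  by rewrite coef0.
by case: na; apply/alg_cl_range; exists (split_head f) => //; apply/eqP.
Qed.

Lemma free_overP s : free_over s <-> rk (@alg_cl L) base s = size s.
Proof.
elim: s => [|a l IH].
  split=> // _ f; have -> : f = (f@_0)%:MP.
    apply/mpolyP => m; rewrite mcoeffC; have -> : m = 0%MM by apply/mnmP; case.
    by rewrite eqxx mulr1.
  by rewrite mmapC => /eqP; rewrite fmorph_eq0 => /eqP ->.
by have := free_over_cons a l; have := rk_free_cons (@alg_cl L) base a l; tauto.
Qed.

End MpolyIndep.

(** * Prime fields, transcendence degree and linear dimension *)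

Section PrimeField.
Local Open Scope ring_scope.

Section Char0.
Variables (L : fieldType) (char0 : has_char 0 L).

Lemma natr_eq0_char0 n : (n%:R == 0 :> L) = (n == 0%N).
Proof. by have /pcharf0P -> := char0. Qed.

Lemma intr_eq0_char0 (z : int) : (z%:~R == 0 :> L) = (z == 0).
Proof. by case: z => n; rewrite ?NegzE ?rmorphN ?oppr_eq0 /= -?pmulrn natr_eq0_char0. Qed.

(** In characteristic [0], [ratr] may be computed from any fraction
    representing the rational; its morphism properties follow. *)
Lemma ratr_frac (a b : int) : b != 0 -> ratr (a%:~R / b%:~R) = a%:~R / b%:~R :> L.
Proof.
move=> b0; rewrite /ratr; set q := a%:~R / b%:~R.
have dL : (denq q)%:~R != 0 :> L by rewrite intr_eq0_char0 denq_eq0.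
have bL : b%:~R != 0 :> L by rewrite intr_eq0_char0.
apply/eqP; rewrite eqr_div // -!rmorphM /=; apply/eqP; congr (_%:~R).
apply: (@intr_inj rat); rewrite !rmorphM /=.
have : (numq q)%:~R / (denq q)%:~R = a%:~R / b%:~R :> rat by rewrite divq_num_den.
by move/eqP; rewrite eqr_div ?intr_eq0 ?denq_eq0 // => /eqP.
Qed.

Lemma ratr_is_zmod_morphism : zmod_morphism (@ratr L).
Proof.
move=> x y; rewrite -[x]divq_num_den -[y]divq_num_den.
have dx := denq_neq0 x; have dy := denq_neq0 y.
move: (numq x) (denq x) (numq y) (denq y) dx dy => a b c d b0 d0.
have dQ z : z != 0 -> z%:~R != 0 :> rat by rewrite intr_eq0.
have dL z : z != 0 -> z%:~R != 0 :> L by rewrite intr_eq0_char0.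
rewrite -mulNr addf_div ?dQ // !ratr_frac // -mulNr addf_div ?dL //.
by rewrite -!rmorphN -!rmorphM -rmorphD ratr_frac ?mulf_neq0 // rmorphD.
Qed.

Lemma ratr_is_monoid_morphism : monoid_morphism (@ratr L).
Proof.
split=> [|x y]; first by rewrite -[1]divr1 (@ratr_frac 1 1) ?divr1.
rewrite -[x]divq_num_den -[y]divq_num_den mulf_div.
have dx := denq_neq0 x; have dy := denq_neq0 y.
move: (numq x) (denq x) (numq y) (denq y) dx dy => a b c d b0 d0.
by rewrite !ratr_frac // -!rmorphM ratr_frac ?mulf_neq0 // !rmorphM mulf_div.
Qed.

Definition ratr_rmorphism : {rmorphism rat -> L} :=
  HB.pack (@ratr L) (GRing.isZmodMorphism.Build _ _ (@ratr L) ratr_is_zmod_morphism)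
    (GRing.isMonoidMorphism.Build _ _ (@ratr L) ratr_is_monoid_morphism).

End Char0.

Lemma Fp_natr_rmorphism (p : nat) (L : fieldType) : p \in [pchar L] ->
  exists phi : {rmorphism 'F_p -> L}, forall x : 'F_p, phi x = (x : nat)%:R.
Proof.
move=> cL; have p_pr := pcharf_prime cL.
have modE m : (modn m p)%:R = m%:R :> L.
  by rewrite {2}(divn_eq m p) natrD natrM (pcharf0 cL) mulr0 add0r.
pose f (x : 'F_p) : L := (x : nat)%:R.
have fZ : zmod_morphism f.
  move=> x y; apply: (addIr (f y)); rewrite subrK /f -natrD -modE.
  have -> : modn (((x - y)%R : 'F_p) + y)%N p = x; last by [].
  have E : modn (((x - y)%R : 'F_p) + y)%N (Zp_trunc (pdiv p)).+2 = x :=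
      congr1 (@nat_of_ord _) (subrK y x).
  by rewrite [X in modn _ X = _](Fp_cast p_pr) in E.
have fM : monoid_morphism f.
  split; first by rewrite /f /= /Zp_trunc /= modn_small // Fp_Zcast ?prime_gt1.
  by move=> x y; rewrite /f -natrM /= [X in modn _ X](Fp_cast p_pr) modE.
pose F := GRing.isZmodMorphism.Build _ _ f fZ.
pose G := GRing.isMonoidMorphism.Build _ _ f fM.
by exists (HB.pack_for {rmorphism 'F_p -> L} f F G).
Qed.

Lemma prime_emb_rmorphism (p : nat) (L : fieldType) : has_char p L ->
  exists phi : {rmorphism prime_field p -> L}, forall x, phi x = prime_emb L x.
Proof.
case: p => [|p] cL; first by exists (ratr_rmorphism cL).
exact: Fp_natr_rmorphism.
Qed.

Lemma alg_cl_prime (p : nat) (L : fieldType) (S : L -> Prop) x : has_char p L ->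
  alg_cl S (@prime_emb p L x).
Proof.
have sf := alg_cl_subfield S.
have natS n : alg_cl S n%:R.
  by elim: n => [|n IH]; [exact: sf0 | rewrite -natr1; apply: (sfD sf) => //; exact: sf1].
have intS (z : int) : alg_cl S z%:~R.
  by case: z => n; rewrite ?NegzE ?rmorphN; [|apply: (sfN sf)]; apply: natS.
case: p x => [|p] x _; last exact: natS.
by apply: (sf_div sf).
Qed.

Lemma free_over_prime (p : nat) (L : fieldType) (phi : {rmorphism prime_field p -> L})
    (s : seq L) : has_char p L -> (forall x, phi x = prime_emb L x) ->
  free_over phi s <-> rk (@alg_cl L) (fun=> False) s = size s.
Proof.
move=> cL phiE; rewrite free_overP.
have -> // : rk (alg_cl (L:=L)) (fun x => exists c, phi c = x) s =
  rk (alg_cl (L:=L)) (fun=> False) s.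
apply/eqP; rewrite eqn_leq !(rk_base_le (@alg_cl_pregeometry L)) //.
by move=> _ [c <-]; rewrite phiE; apply: alg_cl_prime.
Qed.

Lemma trdegE (p : nat) (L : fieldType) (X : seq L) : has_char p L ->
  trdeg p X = rk (@alg_cl L) (fun=> False) X.
Proof.
move=> cL; rewrite /trdeg; apply: (rank_forE (@alg_cl_pregeometry L)) => s.
have [phi phiE] := prime_emb_rmorphism cL.
rewrite -(free_over_prime s cL phiE) /alg_indep /free_over /prime_eval.
by have -> : prime_emb L = phi by apply/funext => x; rewrite phiE.
Qed.

Lemma has_char_morph (p : nat) (K L : fieldType) (f : {rmorphism K -> L}) :
  has_char p K -> has_char p L.
Proof.
by case: p => [|p] /=; [move=> cK q | move=> cK]; rewrite (fmorph_pchar f).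
Qed.

Lemma prime_emb_map (p : nat) (K L : fieldType) (f : {rmorphism K -> L}) x :
  f (@prime_emb p K x) = prime_emb L x.
Proof.
by case: p x => [|p] x /=; [rewrite /ratr fmorph_div !rmorph_int | rewrite rmorph_nat].
Qed.

Lemma free_over_map (k K L : fieldType) (phi : {rmorphism k -> K})
    (f : {rmorphism K -> L}) (s : seq K) :
  free_over phi s -> free_over (f \o phi) (map f s).
Proof.
rewrite /free_over size_map => free g g0; apply: free.
apply: (fmorph_inj f); rewrite rmorph0 -g0 /mmap rmorph_sum; apply: eq_bigr => m _.
rewrite rmorphM rmorph_prod; congr (_ * _); apply: eq_bigr => i _.
by rewrite rmorphXn (nth_map 0).
Qed.

(** Independence is expressed by polynomials over the prime field, hence
    preserved by field morphisms. *)
Lemma rk_alg_map (p : nat) (K L : fieldType) (f : {rmorphism K -> L}) (X : seq K) :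
  has_char p K ->
  (rk (@alg_cl K) (fun=> False) X <= rk (@alg_cl L) (fun=> False) (map f X))%N.
Proof.
move=> cK; have cL := has_char_morph f cK.
have [phi phiE] := prime_emb_rmorphism cK.
have [m sm [rm zm]] := rk_basis (@alg_cl_pregeometry K) (fun=> False) X.
have /(@free_over_map _ _ _ _ f) : free_over phi (mask m X).
  by apply/(free_over_prime _ cK phiE); rewrite rm zm.
have phiE' x : (f \o phi) x = prime_emb L x by rewrite /= phiE prime_emb_map.
move/(free_over_prime _ cL phiE'); rewrite size_map zm => <-.
by rewrite map_mask; apply: (rk_mask (@alg_cl_pregeometry L)).
Qed.

Section Span.
Variables (L : fieldType) (char0 : has_char 0 L).
Implicit Types (S : L -> Prop).

Record subspace (M : L -> Prop) : Prop := Subspace {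
  ss0 : M 0;
  ssD : forall x y, M x -> M y -> M (x + y);
  ssZ : forall (q : rat) x, M x -> M (ratr q * x)
}.

Definition qspan S x := forall M, subspace M -> (forall y, S y -> M y) -> M x.

Lemma ratrV_char0 (q : rat) : ratr q^-1 = (ratr q)^-1 :> L.
Proof. exact: (fmorphV (ratr_rmorphism char0)). Qed.
Lemma ratrD_char0 (q r : rat) : ratr (q + r) = ratr q + ratr r :> L.
Proof. exact: (rmorphD (ratr_rmorphism char0)). Qed.
Lemma ratrM_char0 (q r : rat) : ratr (q * r) = ratr q * ratr r :> L.
Proof. exact: (rmorphM (ratr_rmorphism char0)). Qed.
Lemma ratrN_char0 (q : rat) : ratr (- q) = - ratr q :> L.
Proof. exact: (rmorphN (ratr_rmorphism char0)). Qed.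
Lemma ratr1_char0 : ratr 1 = 1 :> L.
Proof. exact: (rmorph1 (ratr_rmorphism char0)). Qed.
Lemma ratr0_char0 : ratr 0 = 0 :> L.
Proof. exact: (rmorph0 (ratr_rmorphism char0)). Qed.
Lemma ratr_eq0_char0 (q : rat) : (ratr q == 0 :> L) = (q == 0).
Proof. exact: (fmorph_eq0 (ratr_rmorphism char0)). Qed.

Lemma qspan_subspace S : subspace (qspan S).
Proof.
split=> [M [M0 _ _]|x y cx cy M sM SM|q x cx M sM SM] //.
  by apply: (ssD sM); [apply: cx | apply: cy].
by apply: (ssZ sM); apply: cx.
Qed.

Lemma ssB M x y : subspace M -> M x -> M y -> M (x - y).
Proof.
move=> sM Mx My; apply: (ssD sM) => //.
by rewrite -mulN1r -ratr1_char0 -ratrN_char0; apply: (ssZ sM).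
Qed.

Lemma qspan_ext S x : S x -> qspan S x.
Proof. by move=> Sx M _; apply. Qed.

Lemma qspan_mono S (S' : L -> Prop) : (forall x, S x -> qspan S' x) ->
  forall x, qspan S x -> qspan S' x.
Proof. by move=> h x Sx M cM S'M; apply: (Sx M cM) => y /h; apply. Qed.

Lemma qspan_fin S x : qspan S x ->
  exists2 l : seq L, (forall y, y \in l -> S y) & qspan (fun y => y \in l) x.
Proof.
pose Q y := exists2 l : seq L, (forall y, y \in l -> S y) & qspan (fun y => y \in l) y.
move/(_ Q); apply; last first.
  move=> y Sy; exists [:: y] => [z|]; first by rewrite inE => /eqP ->.
  by apply: qspan_ext; rewrite mem_head.
split; first by exists [::] => //; apply: ss0; apply: qspan_subspace.
  move=> y z [l lS hl] [l' l'S hl']; exists (l ++ l').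
    by move=> w; rewrite mem_cat => /orP[/lS|/l'S].
  by apply: (ssD (qspan_subspace _)); [apply: qspan_mono hl | apply: qspan_mono hl'] => w wl;
    apply: qspan_ext; rewrite mem_cat wl ?orbT.
by move=> q y [l lS hl]; exists l => //; apply: (ssZ (qspan_subspace _)).
Qed.

Lemma qspan_adj1 S a x : qspan (adj S [:: a]) x ->
  exists q : rat, qspan S (x - ratr q * a).
Proof.
have sS := qspan_subspace S.
move/(_ (fun x => exists q : rat, qspan S (x - ratr q * a))); apply; last first.
  move=> y [Sy|]; first by exists 0; rewrite ratr0_char0 mul0r subr0; apply: qspan_ext.
  by rewrite inE => /eqP ->; exists 1; rewrite ratr1_char0 mul1r subrr; apply: (ss0 sS).
split; first by exists 0; rewrite ratr0_char0 mul0r subr0; apply: (ss0 sS).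
  move=> y z [q hy] [r hz]; exists (q + r); rewrite ratrD_char0 mulrDl opprD addrACA.
  exact: (ssD sS).
move=> r y [q hy]; exists (r * q); rewrite ratrM_char0 -mulrA -mulrBr.
exact: (ssZ sS).
Qed.

Lemma qspan_exch S a x :
  qspan (adj S [:: a]) x -> ~ qspan S x -> qspan (adj S [:: x]) a.
Proof.
move=> /qspan_adj1[q hq] nx; have [q0|q0] := eqVneq q 0.
  by move: hq; rewrite q0 ratr0_char0 mul0r subr0.
have sS := qspan_subspace (adj S [:: x]).
have -> : a = ratr q^-1 * (x - (x - ratr q * a)).
  by rewrite subKr ratrV_char0 mulKf // ratr_eq0_char0.
apply: (ssZ sS); apply: (ssB sS); first by apply: qspan_ext; right; rewrite mem_head.
by apply: qspan_mono hq => y Sy; apply: qspan_ext; left.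
Qed.

Lemma qspan_pregeometry : pregeometry qspan.
Proof.
split; [exact: qspan_ext | move=> ???; exact: qspan_mono | exact: qspan_fin | exact: qspan_exch].
Qed.

Lemma qspan_seq (s : seq L) x : qspan (adj (fun=> False) s) x <->
  exists c : 'I_(size s) -> rat, x = \sum_i ratr (c i) * s`_i.
Proof.
split=> [|[c ->]]; last first.
  have sS := qspan_subspace (adj (fun=> False) s).
  apply: (big_ind (qspan _) (ss0 sS) (ssD sS)) => i _.
  by apply: (ssZ sS); apply: qspan_ext; right; apply: mem_nth.
move/(_ (fun x => exists c : 'I_(size s) -> rat, x = \sum_i ratr (c i) * s`_i)).
apply; last first.
  move=> y [//|/(nthP 0)[i lt <-]]; exists (fun j => (j == Ordinal lt)%:R).
  rewrite (bigD1 (Ordinal lt)) //= eqxx ratr1_char0 mul1r big1 ?addr0 // => j /negbTE ->.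
  by rewrite ratr0_char0 mul0r.
split; first by exists (fun=> 0); rewrite big1 // => i _; rewrite ratr0_char0 mul0r.
  move=> _ _ [c ->] [d ->]; exists (fun i => c i + d i); rewrite -big_split /=.
  by apply: eq_bigr => i _; rewrite ratrD_char0 mulrDl.
move=> q _ [c ->]; exists (fun i => q * c i); rewrite mulr_sumr.
by apply: eq_bigr => i _; rewrite ratrM_char0 mulrA.
Qed.

Lemma lin_indepP s : lin_indepQ s <-> rk qspan (fun=> False) s = size s.
Proof.
elim: s => [|a l IH]; first by split=> // _ c _ [].
suff : lin_indepQ (a :: l) <-> lin_indepQ l /\ ~ qspan (adj (fun=> False) l) a.
  by have := rk_free_cons qspan (fun=> False) a l; tauto.
split=> [free|[free na] c].
  have free' (c0 : rat) (c : 'I_(size l) -> rat) :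
      ratr c0 * a + \sum_i ratr (c i) * l`_i = 0 -> c0 = 0 /\ forall i, c i = 0.
    pose d (i : 'I_(size l).+1) := if unlift ord0 i is Some j then c j else c0.
    move=> E; have : forall i, d i = 0.
      apply: free; rewrite big_ord_recl /= /d unlift_none -[RHS]E; congr (_ + _).
      by apply: eq_bigr => i _; rewrite liftK.
    move=> d0; split=> [|i]; first by have := d0 ord0; rewrite /d unlift_none.
    by have := d0 (lift ord0 i); rewrite /d liftK.
  split=> [c E|/qspan_seq[c E]].
    by have [] // := free' 0 c; rewrite ratr0_char0 mul0r add0r.
  have [] := free' (- 1) c; last by move/eqP; rewrite oppr_eq0 oner_eq0.
  by rewrite -E ratrN_char0 ratr1_char0 mulN1r addNr.
rewrite big_ord_recl /= => E.
have c0 : c ord0 = 0.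
  apply: contrapT => /eqP nz; apply: na; apply/qspan_seq.
  exists (fun i => - (c ord0)^-1 * c (lift ord0 i)).
  apply: (@mulfI _ (ratr (c ord0))); first by rewrite ratr_eq0_char0.
  move/eqP: E; rewrite addr_eq0 => /eqP ->; rewrite mulr_sumr -sumrN.
  apply: eq_bigr => i _; rewrite ratrM_char0 ratrN_char0 ratrV_char0.
  rewrite (mulNr _ (ratr _)) mulNr mulrN -[in RHS](mulrA _ _ l`_i) mulVKf //.
  by rewrite ratr_eq0_char0.
move: E; rewrite c0 ratr0_char0 mul0r add0r => E i.
have [j ->|-> //] := unliftP ord0 i.
by apply: (free (fun j => c (lift ord0 j))).
Qed.

Lemma dimQE (X : seq L) : dimQ X = rk qspan (fun=> False) X.
Proof. exact: (rank_forE qspan_pregeometry lin_indepP). Qed.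

End Span.

Lemma rk_span_map (K L : fieldType) (f : {rmorphism K -> L}) (X : seq K) :
  has_char 0 K ->
  (rk (@qspan L) (fun=> False) (map f X) <= rk (@qspan K) (fun=> False) X)%N.
Proof.
move=> cK; elim: X => //= a X IH; rewrite leq_add //.
have [ca|na] := EM (qspan (adj (fun=> False) X) a); last by rewrite [X in (_ <= X)%N]jump1 ?leq_b1.
rewrite jump0 // => M sM SM; apply: (ca (fun x => M (f x))) => [|y [//|yX]]; last first.
  by apply: SM; right; apply: map_f.
split=> [|x y Mx My|q x Mx].
- by rewrite rmorph0; apply: (ss0 sM).
- by rewrite rmorphD; apply: (ssD sM).
- rewrite (rmorphM f (ratr q)) (_ : f (ratr q) = ratr q); first exact: (ssZ sM).
  exact: (@prime_emb_map 0).
Qed.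

End PrimeField.

(** * Residue fields of infinite products *)

Section Zorn.

(** Chains are required to be nonempty, as the union of the empty chain is
    usually not an element of the poset. *)
Lemma zorn_union (T : Type) (P : (T -> Prop) -> Prop) :
  (exists A, P A) ->
  (forall F : (T -> Prop) -> Prop, (exists A, F A) -> (forall A, F A -> P A) ->
    (forall A B, F A -> F B -> (forall x, A x -> B x) \/ (forall x, B x -> A x)) ->
    P (fun x => exists2 A, F A & A x)) ->
  exists2 A, P A & forall B, P B -> (forall x, A x -> B x) -> forall x, B x -> A x.
Proof.
move=> [A0 PA0] chain.
pose P' (A : classical_sets.set T) : Prop := (forall x, ~ A x) \/ P A.
have [F FP' Ftot|A [[A_0|PA] maxA]] := @classical_sets.Zorn_bigcup T P'; last 2 first.
- exists A0 => // B PB _ x Bx; apply: contrapT => nx.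
  apply: (maxA B); last by right.
  by split=> [y /A_0//|E]; case: (A_0 x); apply: E.
- exists A => // B PB AB x Bx; apply: contrapT => nx.
  by apply: (maxA B); [split=> // BA; apply/nx/BA | right].
have [[A [FA [x Ax]]]|none] := EM (exists A, F A /\ exists x, A x); last first.
  by left=> x [A FA Ax]; apply: none; exists A; split => //; exists x.
right; pose F' A := F A /\ exists x, A x.
have -> : classical_sets.bigcup F (fun A => A) = (fun x => exists2 A, F' A & A x).
  apply/funext => y; apply/propext; split=> [[B FB By]|[B [FB _] By]]; exists B => //.
  by split=> //; exists y.
apply: chain => [|B [FB [y By]]|B C [FB _] [FC _]]; first by exists A; split=> //; exists x.
  by case: (FP' _ FB) => // /(_ y).
exact: Ftot.
Qed.

End Zorn.

Section Residue.
Local Open Scope ring_scope.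
Variable E : comNzRingType.

Record ideal_axiom (I : E -> Prop) : Prop := IdealAxiom {
  id0 : I 0;
  idD : forall x y, I x -> I y -> I (x + y);
  idM : forall r x, I x -> I (r * x);
  id1 : ~ I 1
}.

Record ideal := Ideal { ideal_set :> E -> Prop; idealP : ideal_axiom ideal_set }.

Definition ideal_mem (I : ideal) : {pred E} := fun x => `[< I x >].

Lemma ideal_mem_closed I : idealr_closed (ideal_mem I).
Proof.
have [I0 ID IM I1] := idealP I; split; first exact/asboolP.
  by apply/negP => /asboolP.
by move=> r x y /asboolP Ix /asboolP Iy; apply/asboolP; apply: ID => //; apply: IM.
Qed.

HB.instance Definition _ I := isIdealr.Build E (ideal_mem I) (ideal_mem_closed I).

Lemma maximal_ideal (I : E -> Prop) : ideal_axiom I ->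
  exists M : ideal, (forall x, I x -> M x) /\
    forall x, ~ M x -> exists r, M (r * x - 1).
Proof.
move=> idI; pose P (J : E -> Prop) := ideal_axiom J /\ forall x, I x -> J x.
have [|F [A0 FA0] FP tot|M [idM' IM] maxM] := @zorn_union E P.
- by exists I.
- split; last by move=> x Ix; exists A0 => //; apply: (FP _ FA0).2.
  split.
  + by exists A0 => //; apply: (id0 (FP _ FA0).1).
  + move=> x y [A FA Ax] [B FB By].
    case: (tot _ _ FA FB) => sub; [exists B => // | exists A => //].
      by apply: (idD (FP _ FB).1) => //; apply: sub.
    by apply: (idD (FP _ FA).1) => //; apply: sub.
  + by move=> r x [A FA Ax]; exists A => //; apply: (idM (FP _ FA).1).
  + by case=> A FA A1; apply: (id1 (FP _ FA).1).
have [M0 MD MM M1] := idM'.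
exists (Ideal idM'); split=> //= x nx; apply: contrapT => no; apply: nx.
pose N y := exists m r, M m /\ y = m + r * x.
suff NM : forall y, N y -> M y by apply: NM; exists 0, 1; rewrite add0r mul1r.
have MN y : M y -> N y by exists y, 0; rewrite mul0r addr0.
apply: maxM => //; split; last by move=> y /IM /MN.
split.
- exact: MN.
- move=> _ _ [m [r [Mm ->]]] [m' [r' [Mm' ->]]]; exists (m + m'), (r + r').
  by rewrite mulrDl addrACA; split=> //; apply: MD.
- move=> s _ [m [r [Mm ->]]]; exists (s * m), (s * r).
  by rewrite mulrDr mulrA; split=> //; apply: MM.
case=> m [r [Mm E1]]; apply: no; exists r.
have -> : r * x - 1 = (-1) * m by rewrite mulN1r E1 opprD addrCA subrr addr0.
exact: MM.
Qed.

Lemma residue_field (I : E -> Prop) : ideal_axiom I ->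
  exists (K : fieldType) (pi : {rmorphism E -> K}), forall x, I x -> pi x = 0.
Proof.
move=> /maximal_ideal[M [IM maxM]].
pose Q := {ideal_quot (ideal_mem M)}.
have piE0 (x : E) : (\pi_Q x = 0)%qT <-> M x.
  rewrite -[0](rmorph0 (\pi_Q)%qT).
  rewrite -[M x](asboolE) -[X in _ <-> is_true X]/(x \in ideal_mem M).
  by rewrite -[x in x \in _]subr0 Quotient.idealrBE; split=> [->|/eqP].
have ex_inv (y : Q) : exists z : Q, (y != 0 -> z * y = 1) /\ (y = 0 -> z = 0).
  have [-> |nz] := eqVneq y 0; first by exists 0; split=> //; rewrite eqxx.
  rewrite -[y]reprK in nz *; set x := repr y in nz *.
  have [|r /piE0] := maxM x; first by move/piE0/eqP; rewrite (negbTE nz).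
  rewrite rmorphB rmorph1 rmorphM => /eqP; rewrite subr_eq0 => /eqP E1.
  by exists (\pi_Q r)%qT; split=> // E0; rewrite E0 eqxx in nz.
have [inv invP] := choice ex_inv.
pose F := GRing.ComNzRing_isField.Build Q (fun y => (invP y).1) ((invP 0).2 erefl).
pose K : fieldType := HB.pack_for fieldType Q F.
exists K, (\pi_Q)%qT.
by move=> x /IM/piE0.
Qed.

End Residue.

(** * Fields with many transcendentals and all roots *)

Section Limit.
Local Open Scope ring_scope.

Section Product.
Variables (J : eqType) (k : seq J -> fieldType).

Definition dprod : Type := forall i, k i.

HB.instance Definition _ := gen_eqMixin dprod.
HB.instance Definition _ := gen_choiceMixin dprod.

Let dprod_ext (x y : dprod) : (forall i, x i = y i) -> x = y.
Proof. by move=> E; apply: functional_extensionality_dep. Qed.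

Definition dprod_zmod := GRing.isZmodule.Build dprod
  (zero := fun i => 0) (opp := fun x i => - x i) (add := fun x y i => x i + y i)
  (fun x y z => dprod_ext (fun i => addrA (x i) (y i) (z i)))
  (fun x y => dprod_ext (fun i => addrC (x i) (y i)))
  (fun x => dprod_ext (fun i => add0r (x i)))
  (fun x => dprod_ext (fun i => addNr (x i))).
HB.instance Definition _ := dprod_zmod.

Let dprod_1neq0 : (fun i => 1 : k i) != 0 :> dprod.
Proof. by apply/eqP => /(congr1 (fun x : dprod => x [::])) /eqP; rewrite oner_eq0. Qed.

Definition dprod_ring := GRing.Zmodule_isComNzRing.Build dprod
  (one := fun i => 1) (mul := fun x y i => x i * y i)
  (fun x y z => dprod_ext (fun i => mulrA (x i) (y i) (z i)))
  (fun x y => dprod_ext (fun i => mulrC (x i) (y i)))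
  (fun x => dprod_ext (fun i => mul1r (x i)))
  (fun x y z => dprod_ext (fun i => mulrDl (x i) (y i) (z i)))
  dprod_1neq0.
HB.instance Definition _ := dprod_ring.

Definition dprod_proj i (x : dprod) : k i := x i.

Lemma dprod_proj_zmod i : zmod_morphism (dprod_proj i). Proof. by []. Qed.
Lemma dprod_proj_monoid i : monoid_morphism (dprod_proj i). Proof. by []. Qed.
HB.instance Definition _ i := GRing.isZmodMorphism.Build dprod (k i) (dprod_proj i)
  (dprod_proj_zmod i).
HB.instance Definition _ i := GRing.isMonoidMorphism.Build dprod (k i) (dprod_proj i)
  (dprod_proj_monoid i).

Variables (K : fieldType) (f : forall i, {rmorphism K -> k i}).
Definition diag (x : K) : dprod := fun i => f i x.

Lemma diag_zmod : zmod_morphism diag.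
Proof. by move=> x y; apply: dprod_ext => i; apply: rmorphB. Qed.
Lemma diag_monoid : monoid_morphism diag.
Proof.
by split=> [|x y]; apply: dprod_ext => i; [apply: rmorph1 | apply: rmorphM].
Qed.
HB.instance Definition _ := GRing.isZmodMorphism.Build K dprod diag diag_zmod.
HB.instance Definition _ := GRing.isMonoidMorphism.Build K dprod diag diag_monoid.

End Product.

(** The families that vanish at all sufficiently large finite stages form a
    proper ideal of the product; in a residue field for a maximal ideal containing
    it, a family invertible at all large stages remains invertible. *)
Lemma limit_field (J : eqType) (k : seq J -> fieldType) :
  exists (L : fieldType) (pi : {rmorphism dprod k -> L}),
    (forall x : dprod k, (exists i0 : seq J, forall i, {subset i0 <= i} -> x i = 0) -> pi x = 0) /\
    (forall x : dprod k, (exists i0 : seq J, forall i, {subset i0 <= i} -> x i != 0) -> pi x != 0).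
Proof.
pose I (x : dprod k) := exists i0 : seq J, forall i, {subset i0 <= i} -> x i = 0.
have idI : ideal_axiom I.
  split.
  - by exists [::].
  - move=> x y [i0 h] [j0 h']; exists (i0 ++ j0) => i sub.
    rewrite -[LHS]/(x i + y i) h ?h' ?addr0 // => z zi; apply: sub; rewrite mem_cat zi ?orbT //.
  - by move=> r x [i0 h]; exists i0 => i /h E; rewrite -[LHS]/(r i * x i) E mulr0.
  - by case=> i0 /(_ i0 (fun _ => id)) /eqP; rewrite -[(1 : dprod k) i0]/(1 : k i0) oner_eq0.
have [L [pi piI]] := residue_field idI; exists L, pi; split=> // x [i0 h].
pose y : dprod k := fun i => (x i)^-1.
have : pi (x * y - 1) = 0.
  by apply: piI; exists i0 => i /h nz; rewrite -[LHS]/(x i * y i - 1) /y divff ?subrr.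
rewrite rmorphB rmorphM rmorph1 => /eqP; rewrite subr_eq0 => /eqP E.
by apply: contra_eq_neq E => ->; rewrite mul0r eq_sym oner_eq0.
Qed.

Lemma rmorph_mmap n (k : nzRingType) (R S : comNzRingType) (f : {rmorphism R -> S})
    (phi : k -> R) (h : 'I_n -> R) (p : {mpoly k[n]}) :
  f (mmap phi h p) = mmap (f \o phi) (f \o h) p.
Proof.
rewrite /mmap rmorph_sum; apply: eq_bigr => m _; rewrite rmorphM rmorph_prod /=.
by congr (_ * _); apply: eq_bigr => i _; rewrite rmorphXn.
Qed.

Lemma eq_mmap n (k : nzRingType) (R : comNzRingType) (phi phi' : k -> R) (h h' : 'I_n -> R) p :
  phi =1 phi' -> h =1 h' -> mmap phi h p = mmap phi' h' p.
Proof. by move=> /funext -> /funext ->. Qed.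

Lemma mmap_id n (k : comNzRingType) (p : {mpoly k[n]}) :
  mmap (@mpolyC n k) (fun i => 'X_i) p = p.
Proof.
apply: (@mpoly_ext _ _ _ (mmap (@mpolyC n k) (fun i => 'X_i)) idfun) => [c|i] /=.
  exact: mmapC.
by rewrite mmapX mmap1U.
Qed.

(** At a finite stage [i], the transcendentals named in [i] are the variables
    of a rational function field. *)
Lemma transcendental_family (k : fieldType) (J : eqType) :
  exists (L : fieldType) (f : {rmorphism k -> L}) (s : J -> L),
    forall us : seq J, uniq us -> free_over f (map s us).
Proof.
pose kk (i : seq J) : fieldType := {fraction {mpoly k[size i]}}.
pose g i : {rmorphism k -> kk i} := @tofrac _ \o @mpolyC (size i) k.
pose X (i : seq J) (u : J) : {mpoly k[size i]} :=
  if insub (index u i) is Some j then 'X_j else 0.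
have [L [pi [_ pi_neq0]]] := limit_field kk.
pose t (u : J) : dprod kk := fun i => tofrac (X i u).
exists L, (pi \o diag g), (fun u => pi (t u)) => us uus.
pose u (i : 'I_(size us)) := tnth (in_tuple us) i.
have nth_u (T : nmodType) (h : J -> T) (i : 'I_(size us)) : (map h us)`_i = h (u i).
  by rewrite /u (tnth_nth (tnth (in_tuple us) i)) (nth_map (tnth (in_tuple us) i)).
have u_in i : u i \in us by apply: mem_tnth.
rewrite /free_over size_map => p p0; apply: contrapT => /eqP pn0.
have pE : mmap (pi \o diag g) (fun i : 'I_(size us) => (map (fun u => pi (t u)) us)`_i) p =
    pi (mmap (diag g) (fun i => t (u i)) p).
  by rewrite rmorph_mmap; apply: eq_mmap => // i; rewrite nth_u.
move: p0; rewrite pE; apply/eqP; apply: pi_neq0; exists us => i sub.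
set z := mmap _ _ _; rewrite -[z i]/(dprod_proj i z) /z rmorph_mmap.
pose ev := mmap (@mpolyC (size i) k) (fun j => X i (u j)).
have -> : mmap (dprod_proj (k:=kk) i \o diag g) (dprod_proj (k:=kk) i \o (fun j => t (u j))) p
    = tofrac (ev p) by rewrite /ev (rmorph_mmap (@tofrac _)).
rewrite tofrac_eq0; apply: contraNneq pn0 => ev0.
(* The renaming of variables has a left inverse. *)
pose back : {mpoly k[size i]} -> {mpoly k[size us]} :=
  mmap (@mpolyC (size us) k) (fun m : 'I_(size i) =>
    if [pick j | u j == tnth (in_tuple i) m] is Some j then 'X_j else 0).
suff <- : back (ev p) = p by rewrite ev0 /back rmorph0.
rewrite /ev /back rmorph_mmap -[RHS]mmap_id; apply: eq_mmap => [c|j] /=; first exact: mmapC.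
have lt : (index (u j) i < size i)%N by rewrite index_mem; apply: sub.
rewrite /X insubT mmapX mmap1U.
case: pickP => [j' /eqP|/(_ j)].
  rewrite (tnth_nth (u j)) /= nth_index ?sub // /u => E; congr 'X_[U_(_)].
  apply: val_inj => /=; apply/eqP.
  rewrite -(nth_uniq (u j) _ _ uus) //.
  by rewrite -[us]/(tval (in_tuple us)) -!tnth_nth E.
by rewrite (tnth_nth (u j)) /= nth_index ?sub // eqxx.
Qed.

Lemma splits_somewhere (k : fieldType) (p : {poly k}) : p != 0 ->
  exists (L : fieldType) (f : {rmorphism k -> L}) (rs : seq L),
    map_poly f p %= \prod_(r <- rs) ('X - r%:P).
Proof.
have [n] := ubnP (size p); elim: n k p => // n IH k p; rewrite ltnS => le p0.
have [le1|gt1] := leqP (size p) 1.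
  exists k, idfun, [::]; rewrite big_nil map_poly_id //.
  by rewrite -size_poly_eq1 eqn_leq le1 size_poly_gt0.
have ex : exists m, `[< exists q : {poly k}, [/\ size q = m, (1 < m)%N & q %| p] >].
  by exists (size p); apply/asboolP; exists p; rewrite dvdpp.
have [m /asboolP[q [sq m1 qp]] min] := ex_minnP ex.
have q0 : q != 0 by rewrite -size_poly_gt0 sq ltnW.
have irr_q : irreducible_poly q.
  split=> [|d d1 dq]; first by rewrite sq.
  have d0 : d != 0 by apply: contraNneq q0 => E; rewrite E dvd0p in dq.
  rewrite -(dvdp_size_eqp dq) eqn_leq dvdp_leq //= sq; apply: min; apply/asboolP.
  exists d; split=> //; last exact: dvdp_trans qp.
  by rewrite ltn_neqAle eq_sym d1 size_poly_gt0.
have [L _ [z rz _]] := irredp_FAdjoin irr_q.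
pose f1 : {rmorphism k -> L} := in_alg L.
have rp : root (map_poly f1 p) z.
  by move: qp => /dvdpP[d ->]; rewrite rmorphM rootM; apply/orP; right; exact: rz.
have [p1 p1E] := factor_theorem _ _ rp.
have p10 : p1 != 0.
  apply: contraNneq p0 => E; move: p1E; rewrite E mul0r => /eqP.
  by rewrite map_poly_eq0.
have [|L2 [f2 [rs frs]]] := IH L p1 _ p10.
  rewrite (leq_trans _ le) // -(size_map_poly f1) p1E size_Mmonic ?monicXsubC //.
  by rewrite size_XsubC addn2.
exists L2, (f2 \o f1), (f2 z :: rs); rewrite big_cons map_poly_comp p1E rmorphM /=.
by rewrite map_polyXsubC mulrC eqp_mul2l ?polyXsubC_eq0.
Qed.

(** A single limit over finite sets of polynomials splits all of them at once. *)
Lemma splits_all (k : fieldType) : exists (L : fieldType) (f : {rmorphism k -> L}),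
  forall p : {poly k}, p != 0 -> exists rs : seq L,
    map_poly f p %= \prod_(r <- rs) ('X - r%:P).
Proof.
pose big (i : seq {poly k}) := \prod_(q <- i | q != 0) q.
have big0 i : big i != 0 by rewrite /big; elim/big_ind: _ => [||q] //; [exact: oner_neq0 | exact: mulf_neq0].
have [kk kkP] := choice (fun i => splits_somewhere (big0 i)).
pose g i := sval (cid (kkP i)); have gP i := svalP (cid (kkP i)); rewrite -/(g _) in gP.
have [L [pi [pi0 _]]] := limit_field kk.
exists L, (pi \o diag g) => p p0; set m := (size p).-1.
have split_i (i : seq {poly k}) : exists r : nat -> kk i, p \in i ->
    map_poly (g i) p = (g i (lead_coef p)) *: \prod_(j < m) ('X - (r j)%:P).
  case: (boolP (p \in i)) => [pin|_]; last by exists (fun=> 0).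
  have [rs rsE] := gP i.
  have : map_poly (g i) p %| \prod_(r <- rs) ('X - r%:P).
    rewrite -(eqp_dvdr _ rsE) dvdp_map; apply: dvdp_trans (dvdpp _).
    by rewrite /big (big_rem p) //= p0 dvdp_mulr.
  case/dvdp_prod_XsubC => msk; set rs' := mask msk rs => E.
  exists (fun j => rs'`_j) => _.
  have mE : m = size rs'.
    by have := eqp_size E; rewrite size_map_poly size_prod_XsubC /m => ->.
  rewrite mE -(big_mkord xpredT (fun j => 'X - (rs'`_j)%:P)).
  rewrite -(big_nth 0 xpredT (fun r => 'X - r%:P)).
  have /eqpP[[c d] /= /andP[c0 d0] cd] := E.
  have := congr1 lead_coef cd; rewrite !lead_coefZ lead_coef_map.
  rewrite (monicP (monic_prod_XsubC _ _ _)) mulr1 => dE.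
  apply: (scalerI c0); rewrite cd -dE scalerA; exact: erefl.
pose r i := sval (cid (split_i i)); have rP i := svalP (cid (split_i i)); rewrite -/(r _) in rP.
pose rr j : dprod kk := fun i => r i j.
pose D : {poly dprod kk} := map_poly (diag g) p -
  diag g (lead_coef p) *: \prod_(j < m) ('X - (rr j)%:P).
have D0 : map_poly pi D = 0.
  apply/polyP => n; rewrite coef_map coef0; apply: pi0; exists [:: p] => i sub.
  have pin : p \in i by apply: sub; rewrite mem_head.
  rewrite -[D`_n i]/(dprod_proj i D`_n) -coef_map rmorphB /= map_polyZ /=.
  rewrite -map_poly_comp /= rmorph_prod /=.
  have -> : map_poly (dprod_proj (k:=kk) i \o diag g) p = map_poly (g i) p.
    exact: eq_map_poly.
  have -> : \prod_(j < m) map_poly (dprod_proj (k:=kk) i) ('X - (rr j)%:P) =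
      \prod_(j < m) ('X - (r i j)%:P).
    by apply: eq_bigr => j _; rewrite map_polyXsubC.
  rewrite (rP i pin) -[dprod_proj i (diag _ _)]/(g i (lead_coef p)).
  by rewrite subrr coef0.
exists [seq pi (rr j) | j <- index_iota 0 m].
have -> : map_poly (pi \o diag g) p =
    pi (diag g (lead_coef p)) *: \prod_(j < m) ('X - (pi (rr j))%:P).
  apply/eqP; rewrite -subr_eq0 -D0 rmorphB /= map_polyZ -map_poly_comp rmorph_prod /=.
  by apply/eqP; congr (_ - _ *: _); apply: eq_bigr => j _; rewrite map_polyXsubC.
rewrite big_map big_mkord.
by apply: eqp_scale; rewrite -[pi _]/((pi \o diag g) _) fmorph_eq0 lead_coef_eq0.
Qed.

Lemma split_horner_root (L : fieldType) (p : {poly L}) (rs : seq L) x n :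
  p %= \prod_(r <- rs) ('X - r%:P) -> 'X^(n.+1) - x%:P %| p -> exists y, y ^+ n.+1 = x.
Proof.
move=> pE; rewrite (eqp_dvdr _ pE) => /dvdp_prod_XsubC[m E].
case: (mask m rs) E => [|y ys E].
  by rewrite big_nil => /eqp_size; rewrite size_XnsubC // size_poly1.
exists y; apply/eqP; rewrite -subr_eq0.
have : root ('X^(n.+1) - x%:P) y by rewrite (eqp_root E) big_cons rootM root_XsubC eqxx.
by rewrite /root !hornerE.
Qed.

(** The roots of an element annihilated by [p] are roots of [p (X ^ (n + 1))], so
    that splitting all the polynomials over the field with the family is enough:
    the splitting need not be iterated. *)
Lemma big_field (k : fieldType) (J : eqType) :
  exists (L : fieldType) (f : {rmorphism k -> L}) (s : J -> L),
    (forall us : seq J, uniq us -> free_over f (map s us)) /\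
    forall n x, alg_cl (fun y => (exists c, f c = y) \/ (exists u, s u = y)) x ->
      exists y, y ^+ n.+1 = x.
Proof.
have [L1 [f1 [s1 free1]]] := transcendental_family k J.
have [L [f2 split2]] := splits_all L1.
exists L, (f2 \o f1), (f2 \o s1); split=> [us uus|n x].
  by rewrite map_comp; apply: free_over_map; apply: free1.
case/(_ (alg_over_image f2)).
- exact: alg_over_image_closed.
- by move=> y [[c <-]|[u <-]]; apply: alg_over_image_id.
move=> p; rewrite map_poly_eq0 => p0 rp.
have p0' : p \Po 'X^(n.+1) != 0.
  by rewrite comp_poly_eq0 // size_polyXn.
have [rs rsE] := split2 _ p0'; apply: split_horner_root rsE _.
rewrite map_comp_poly map_polyXn.
have /factor_theorem[q ->] := rp.
by rewrite comp_polyM comp_polyB comp_polyX comp_polyC dvdp_mull.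
Qed.

End Limit.

(** * Two fields indexed by each other *)

Section Terms.
Local Open Scope ring_scope.

(** The preimage of a relatively algebraically closed subfield is one. *)
Lemma alg_cl_map (K L : fieldType) (f : {rmorphism K -> L}) (S : K -> Prop) x :
  alg_cl S x -> alg_cl (fun y => exists2 z, S z & f z = y) (f x).
Proof.
move=> cx M [sM aM] SM; apply: (cx (fun x => M (f x))) => [|y Sy]; last first.
  by apply: SM; exists y.
split; first split.
- by rewrite rmorph1; apply: (sf1 sM).
- by move=> y z My Mz; rewrite rmorphB; apply: (sfB sM).
- by move=> y z My Mz; rewrite fmorph_div; apply: (sf_div sM).
move=> p y p0 Mp rp; apply: (aM (map_poly f p)); first by rewrite map_poly_eq0.
  by move=> i; rewrite coef_map; apply: Mp.
by rewrite fmorph_root.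
Qed.

Definition base_with (k L : fieldType) (T : Type) (f : k -> L) (s : T -> L) (V : T -> Prop)
  (y : L) : Prop := (exists c, f c = y) \/ (exists2 u, V u & s u = y).

Lemma free_family (k L : fieldType) (T : eqType) (f : {rmorphism k -> L}) (s : T -> L) :
  (forall us, uniq us -> free_over f (map s us)) ->
  forall t, ~ alg_cl (base_with f s (fun u => u <> t)) (s t).
Proof.
move=> free t /alg_cl_fin[l lS cl].
have {lS} [us [uus tus lus]] : exists us : seq T, [/\ uniq us, t \notin us &
    forall y, y \in l -> (exists c, f c = y) \/ y \in map s us].
  elim: l lS {cl} => [|a l IH] lS; first by exists [::].
  have [|us [uus tus lus]] := IH; first by move=> y yl; apply: lS; rewrite inE yl orbT.
  have [[c ca]|[u ut ua]] := lS a (mem_head _ _).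
    exists us; split=> // y; rewrite inE => /orP[/eqP ->|/lus//]; by left; exists c.
  exists (undup (u :: us)); split; first exact: undup_uniq.
    by rewrite mem_undup inE negb_or tus andbT; apply/eqP => E; apply: ut.
  have sub y : y \in us -> y \in undup (u :: us) by rewrite mem_undup inE orbC => ->.
  move=> y; rewrite inE => /orP[/eqP ->|/lus[|/mapP[v vus ->]]]; [right| by left |right].
    by rewrite -ua map_f // mem_undup mem_head.
  by rewrite map_f // sub.
have /free_over_cons[_] : free_over f (map s (t :: us)) by apply: free; rewrite /= tus.
apply; apply: (alg_cl_mono _ cl) => y /lus yP; apply: alg_cl_ext.
by case: yP => [[c <-]|]; [left; exists c | right].
Qed.

(** Names for the elements of both fields of the structure under construction.
    [Var t] names, in either field, a generic element reserved for the element
    that [t] names in the other field; the recursion is what makes the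
    reservation well founded. *)
Inductive term (C : Type) : Type :=
| Cst of C
| Var of term C
| Sub of term C & term C
| Div of term C & term C
| Root of nat & term C.

HB.instance Definition _ C := gen_eqMixin (term C).

Section Eval.
Variables (C : Type) (L : fieldType) (c : C -> L) (s : term C -> L) (rt : nat -> L -> L).

Fixpoint eval (t : term C) : L :=
  match t with
  | Cst a => c a
  | Var u => s (Var u)
  | Sub u v => eval u - eval v
  | Div u v => eval u / eval v
  | Root n u => rt n (eval u)
  end.
End Eval.

(** The values of the terms form a subfield of a big enough field, and the family
    indexed by all the terms remains independent in it.  The constants [C] are
    allowed to be more than the base field, since the same terms are evaluated in
    both fields. *)
Lemma term_field (C : Type) (k : fieldType) (c : C -> k) :
  (forall a, exists x, c x = a) ->
  exists (L : fieldType) (f : {rmorphism k -> L}) (s e : term C -> L),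
  [/\ forall t, ~ alg_cl (base_with f s (fun u => u <> t)) (s t),
      forall x, exists t, e t = x,
      (forall a, e (Cst a) = f (c a)) /\ (forall t, e (Var t) = s t),
      (forall t u, e (Sub t u) = e t - e u) /\ (forall t u, e (Div t u) = e t / e u)
    & forall n t, e (Root n t) ^+ n.+1 = e t].
Proof.
move=> c_onto; have [M [f [s [free roots]]]] := big_field k (term C).
have ex_root n (x : M) : exists y, (exists z, z ^+ n.+1 = x) -> y ^+ n.+1 = x.
  by have [[z zx]|no] := EM (exists z, z ^+ n.+1 = x); [exists z | exists 0].
have [rt rtP] : exists rt : nat -> M -> M,
    forall n x, (exists z, z ^+ n.+1 = x) -> rt n x ^+ n.+1 = x.
  exists (fun n => projT1 (choice (ex_root n))) => n.
  exact: (projT2 (choice (ex_root n))).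
pose s' (t : term C) := if t is Var u then s u else 0.
pose ev := eval (f \o c) s' rt.
have sub_ev : subfield_axiom (fun x => exists t, ev t = x).
  split.
  - by have [a ca] := c_onto 1; exists (Cst a); rewrite /ev /= ca rmorph1.
  - by move=> _ _ [t <-] [u <-]; exists (Sub t u).
  - by move=> _ _ [t <-] [u <-]; exists (Div t u).
pose LL := SubfieldSet sub_ev.
have ev_alg t : alg_cl (fun y => (exists a, f a = y) \/ (exists u, s u = y)) (ev t).
  set S := fun y => _; have sf := alg_cl_subfield S.
  elim: t => [a|u _|u IHu v IHv|u IHu v IHv|n u IHu].
  - by apply: alg_cl_ext; left; exists (c a).
  - by apply: alg_cl_ext; right; exists u.
  - exact: (sfB sf).
  - exact: (sf_div sf).
  - by apply: (@alg_cl_root _ _ _ n); rewrite /ev /= rtP //; apply: roots.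
have [e eE] := choice (fun t => @subfield_onto _ LL (ev t) (ex_intro _ t erefl)).
have eval_onto (x : subfield LL) : exists t, e t = x.
  by have [t tx] := subfieldP x; exists t; apply: val_inj; rewrite eE.
have [g gE] : exists g : k -> subfield LL, forall a, val (g a) = f a.
  suff /choice[g gE] : forall a, exists y : subfield LL, val y = f a by exists g.
  move=> a; have [x xa] := c_onto a; apply: (@subfield_onto _ LL (f a)).
  by exists (Cst x); rewrite /ev /= xa.
have graphZ : zmod_morphism g by move=> x y; apply: val_inj; rewrite /= !gE rmorphB.
have gM : monoid_morphism g.
  by split=> [|x y]; apply: val_inj; rewrite /= !gE ?rmorph1 ?rmorphM.
pose G : {rmorphism k -> subfield LL} := HB.pack_for {rmorphism k -> subfield LL} g
  (GRing.isZmodMorphism.Build _ _ g graphZ) (GRing.isMonoidMorphism.Build _ _ g gM).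
exists (subfield LL), G, (fun t => e (Var t)), e; split=> //.
- move=> t /(@alg_cl_map _ M (val : subfield LL -> M)) cl.
  apply: (free_family free (t := t)).
  rewrite -[s t]/(ev (Var t)) -eE; apply: (alg_cl_mono _ cl) => y [z zS <-].
  apply: alg_cl_ext; case: zS => [[a <-]|[u ut <-]]; first by left; exists a; apply/esym/gE.
  by right; exists u => //; apply/esym/(eE (Var u)).
- by split=> // a; apply: val_inj; rewrite eE gE.
- by split=> t u; apply: val_inj; rewrite /= !eE.
- move=> n t; apply: val_inj; rewrite rmorphXn -[RHS]/(val (e t)).
  rewrite -[LHS]/(val (e (Root n t)) ^+ n.+1) !eE /ev /= rtP //.
  exact: roots.
Qed.

End Terms.

(** * Extending the graph of an exponential by one element *)

Section RationalPowers.
Local Open Scope ring_scope.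
Variable F : fieldType.

(** A homomorphism from the rationals to the multiplicative group; [psi q] is
    a choice of the power [psi 1 ^ q]. *)
Definition power_system (psi : rat -> F) : Prop :=
  (forall q r, psi (q + r) = psi q * psi r) /\ psi 1 != 0.

Section Facts.
Variables (psi : rat -> F) (psiP : power_system psi).

Lemma power0 : psi 0 = 1.
Proof. by apply: (mulIf psiP.2); rewrite -psiP.1 add0r mul1r. Qed.

Lemma power_neq0 q : psi q != 0.
Proof.
apply/eqP => E; have := power0; rewrite -(subrr q) psiP.1 E mul0r => /esym/eqP.
by rewrite oner_eq0.
Qed.

Lemma powerN q : psi (- q) = (psi q)^-1.
Proof. by apply: (mulIf (power_neq0 q)); rewrite -psiP.1 addNr power0 mulVf ?power_neq0. Qed.

Lemma powerB q r : psi (q - r) = psi q / psi r.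
Proof. by rewrite psiP.1 powerN. Qed.

Lemma powerMn q n : psi (q *+ n) = psi q ^+ n.
Proof. by elim: n => [|n IH]; rewrite ?power0 // mulrS psiP.1 IH exprS. Qed.

Lemma powerMz q (m : int) : psi (q *~ m) = psi q ^ m.
Proof. by case: m => n; rewrite ?NegzE ?mulrNz ?powerN -pmulrn powerMn. Qed.

Lemma power_alg S q r : alg_cl S (psi q) -> alg_cl S (psi (r * q)).
Proof.
move=> Sq; have sf := alg_cl_subfield S.
have E : (r * q) *+ `|denq r|%N = q *~ numq r.
  rewrite pmulrn absz_denq -[LHS]mulrzr -[RHS]mulrzr.
  by rewrite mulrAC mulrC -{1}[r]divq_num_den divfK ?intr_eq0 ?denq_eq0.
have [n nE] : exists n, `|denq r|%N = n.+1.
  by exists `|denq r|%N.-1; rewrite prednK // absz_gt0 denq_eq0.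
apply: (@alg_cl_root _ _ _ n); rewrite -nE -powerMn E powerMz.
by case: (numq r) => m; rewrite ?NegzE -?exprnN -?exprnP; [|apply: (sfV sf)]; apply: (sfX _ sf).
Qed.
End Facts.

(** Compatible roots are obtained by extracting an [(n+1)]-th root at step [n]:
    the result plays the role of [e ^ (1 / n!)]. *)
Lemma power_system_through (e : F) : e != 0 ->
  (forall n (x : F), exists y, y ^+ n.+1 = x) ->
  exists2 psi, power_system psi & psi 1 = e.
Proof.
move=> e0 roots.
pose rt n := projT1 (choice (roots n)).
have rtE n x : rt n x ^+ n.+1 = x := projT2 (choice (roots n)) x.
pose fix ee n := if n is m.+1 then rt m (ee m) else e.
have eeS n : ee n.+1 ^+ n.+1 = ee n by rewrite /= rtE.
have ee0 n : ee n != 0.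
  elim: n => // n IH; apply: contraNneq IH => E; by rewrite -eeS E expr0n.
have ee_add n k : exists m : nat, ((n + k)`! = m * n`!)%N /\ ee (n + k)%N ^+ m = ee n.
  elim: k => [|k [m [fE eE]]]; first by exists 1%N; rewrite addn0 mul1n expr1.
  exists ((n + k).+1 * m)%N; rewrite addnS factS fE mulnA exprM eeS eE; by [].
pose P (q : rat) (y : F) := exists n (m : int), q * (n`!)%:R = m%:~R /\ y = ee n ^ m.
have lift n k (m : int) (q : rat) : q * (n`!)%:R = m%:~R -> exists m' : int,
    q * ((n + k)`!)%:R = m'%:~R /\ ee n ^ m = ee (n + k)%N ^ m'.
  move=> E; have [a [fE eE]] := ee_add n k; exists (a%:Z * m); split.
    by rewrite fE natrM mulrCA E rmorphM /= pmulrn.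
  by rewrite -exprz_exp -exprnP eE.
have fn0 n : (n`!)%:R != 0 :> rat by rewrite Num.Theory.pnatr_eq0 -lt0n fact_gt0.
have common (q r : rat) y z : P q y -> P r z -> exists n (m m' : int),
   [/\ q * (n`!)%:R = m%:~R, r * (n`!)%:R = m'%:~R, y = ee n ^ m & z = ee n ^ m'].
  move=> [n [m [qE ->]]] [n' [m' [rE ->]]].
  have [a [qa ->]] := lift n n' m q qE.
  have [b [rb ->]] := lift n' n m' r rE.
  by exists (n + n')%N, a, b; split=> //; rewrite addnC.
have Pfun q y z : P q y -> P q z -> y = z.
  move=> Py Pz; have [n [m [m' [qE qE' -> ->]]]] := common _ _ _ _ Py Pz.
  by move: qE'; rewrite qE => /intr_inj ->.
have Pex q : exists y, P q y.
  pose d := `|denq q|%N; have d0 : (0 < d)%N by rewrite absz_gt0 denq_eq0.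
  exists (ee d ^ (numq q * (d.-1)`!%:Z)), d, (numq q * (d.-1)`!%:Z); split=> //.
  rewrite -{1}(prednK d0) factS prednK // natrM mulrA rmorphM /=; congr (_ * _).
  by rewrite -{1}[q]divq_num_den -[d%:R]/(d%:~R) /d absz_denq divfK // intr_eq0 denq_eq0.
have [psi psiE] := choice Pex; exists psi.
  split=> [q r|]; last by have [n [m [_ ->]]] := psiE 1; apply: expfz_neq0.
  have [n [m [m' [qE rE -> ->]]]] := common _ _ _ _ (psiE q) (psiE r).
  apply: (Pfun _ _ _ (psiE _)); exists n, (m + m').
  by rewrite mulrDl qE rE rmorphD /= expfzDr.
by apply: (Pfun _ _ _ (psiE _)); exists 0%N, 1; rewrite mulr1 expr1z.
Qed.

End RationalPowers.

Section Graphs.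
Local Open Scope ring_scope.
Variables (K F : fieldType) (charK : has_char 0 K).
Implicit Types (G B : K * F -> Prop).

(** The graph of a homomorphism to the multiplicative group, defined on a
    divisible subgroup of [K]. *)
Record exp_graph G : Prop := ExpGraph {
  graph1 : G (0, 1);
  graphB : forall x y x' y', G (x, y) -> G (x', y') -> G (x - x', y / y');
  graph_neq0 : forall x y, G (x, y) -> y != 0;
  graph_div : forall n x y, G (x, y) ->
    exists x' y', [/\ G (x', y'), x' *+ n.+1 = x & y' ^+ n.+1 = y];
  graph_fun : forall y, G (0, y) -> y = 1
}.

Definition dom G x := exists y, G (x, y).
Definition ran G y := exists x, G (x, y).

Section Facts.
Variables (G : K * F -> Prop) (gG : exp_graph G).

Lemma graphN x y : G (x, y) -> G (- x, y^-1).
Proof. by move=> h; rewrite -sub0r -div1r; apply: (graphB gG) => //; apply: graph1. Qed.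

Lemma graphD x y x' y' : G (x, y) -> G (x', y') -> G (x + x', y * y').
Proof.
by move=> h /graphN h'; rewrite -[x']opprK -[y']invrK; apply: (graphB gG).
Qed.

Lemma graphMn x y n : G (x, y) -> G (x *+ n, y ^+ n).
Proof.
move=> h; elim: n => [|n IH]; first exact: (graph1 gG).
by rewrite mulrS exprS; apply: graphD.
Qed.

Lemma graph_functional x y y' : G (x, y) -> G (x, y') -> y = y'.
Proof.
move=> h h'; have := graphB gG h h'; rewrite subrr => /(graph_fun gG).
by apply: divr1_eq.
Qed.

(** Rational multiples are unique in [K] but only determined up to a root
    of unity in [F], and this is harmless for algebraic closure. *)
Lemma graphZ (q : rat) x y : G (x, y) ->
  exists2 w, G (ratr q * x, w) & alg_cl (fun z => z = y) w.
Proof.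
move=> h; have [n nE] : exists n, `|denq q|%N = n.+1.
  by exists `|denq q|%N.-1; rewrite prednK // absz_gt0 denq_eq0.
have [x' [y' [h' <- yE]]] := graph_div gG n h.
have sf := alg_cl_subfield (fun z : F => z = y).
have y'alg : alg_cl (fun z => z = y) y'.
  by apply: (@alg_cl_root _ _ _ n); rewrite yE; apply: alg_cl_ext.
have xE : ratr q * (x' *+ n.+1) = x' *~ numq q.
  rewrite -nE -mulr_natr -mulrzr /ratr mulrCA pmulrn absz_denq divfK //.
  by rewrite intr_eq0_char0 ?denq_eq0.
rewrite xE; case: (numq q) => m.
  by exists (y' ^+ m); [apply: graphMn | apply: (sfX _ sf)].
rewrite NegzE mulrNz; exists (y' ^+ m.+1)^-1; first by apply: graphN; apply: graphMn.
by apply: (sfV sf); apply: (sfX _ sf).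
Qed.

Lemma dom_subspace : subspace (dom G).
Proof.
split=> [|x x' [y h] [y' h']|q x [y h]]; first by exists 1; apply: (graph1 gG).
  by exists (y * y'); apply: graphD.
by have [w hw _] := graphZ q h; exists w.
Qed.

Lemma domZ (q : rat) x : q != 0 -> dom G (ratr q * x) -> dom G x.
Proof.
move=> q0 /(ssZ dom_subspace q^-1); rewrite ratrV_char0 // mulKf //.
by rewrite ratr_eq0_char0.
Qed.

End Facts.

Definition ext G (d : K) (psi : rat -> F) (z : K * F) : Prop :=
  exists x y q, G (x, y) /\ z = (x + ratr q * d, y * psi q).

Section Extend.
Variables (G : K * F -> Prop) (gG : exp_graph G) (d : K) (psi : rat -> F).
Hypotheses (psiP : power_system psi) (nd : ~ dom G d).

Lemma ext_sub z : G z -> ext G d psi z.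
Proof.
case: z => x y h; exists x, y, 0.
by rewrite ratr0_char0 // mul0r addr0 (power0 psiP) mulr1.
Qed.

Lemma ext_new : ext G d psi (d, psi 1).
Proof.
by exists 0, 1, 1; rewrite ratr1_char0 // mul1r add0r mul1r; split=> //; apply: (graph1 gG).
Qed.

Lemma ext_coef0 x q : dom G x -> dom G (x + ratr q * d) -> q = 0.
Proof.
move=> hx h; apply: contrapT => /eqP q0; apply/nd/(domZ gG q0).
by have := ssB charK (dom_subspace gG) h hx; rewrite addrC addKr.
Qed.

Lemma ext_old x y : ext G d psi (x, y) -> dom G x -> G (x, y).
Proof.
move=> [x' [y' [q [h [-> ->]]]]] hx.
have -> : q = 0 by apply: ext_coef0 hx; exists y'.
by rewrite ratr0_char0 // mul0r addr0 (power0 psiP) mulr1.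
Qed.

Lemma ext_graph : exp_graph (ext G d psi).
Proof.
split.
- by apply: ext_sub; apply: (graph1 gG).
- move=> _ _ _ _ [x [y [q [h [-> ->]]]]] [x' [y' [q' [h' [-> ->]]]]].
  exists (x - x'), (y / y'), (q - q'); split; first exact: (graphB gG).
  rewrite ratrD_char0 // ratrN_char0 // mulrDl mulNr powerB // opprD addrACA.
  by rewrite mulf_div.
- move=> _ _ [x [y [q [h [_ ->]]]]].
  by apply: mulf_neq0; [exact: (graph_neq0 gG h) | exact: (power_neq0 psiP)].
- move=> n _ _ [x [y [q [h [-> ->]]]]]; have [x' [y' [h' <- <-]]] := graph_div gG n h.
  have qE : (q / n.+1%:R) *+ n.+1 = q.
    by rewrite -mulr_natr divfK // Num.Theory.pnatr_eq0.
  exists (x' + ratr (q / n.+1%:R) * d), (y' * psi (q / n.+1%:R)); split.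
  + by exists x', y', (q / n.+1%:R).
  + rewrite mulrnDl; congr (_ + _); rewrite -mulrnAl; congr (_ * _).
    by rewrite -[in RHS]qE -[RHS]/(ratr_rmorphism charK _) raddfMn.
  + by rewrite exprMn -(powerMn psiP) qE.
- move=> y h; have /(graph_fun gG) // : G (0, y).
  by apply: ext_old => //; exists 1; apply: (graph1 gG).
Qed.

Hypotheses (ne : ~ ran G (psi 1))
  (torsion : forall n (z : F), z ^+ n.+1 = 1 -> ran G z).

(** Since the range is divisible, [y ^ (n + 1)] has in it a root, which differs
    from [y] by a root of unity. *)
Lemma ran_root n y : ran G (y ^+ n.+1) -> ran G y.
Proof.
move=> [x h]; have [x' [y' [h' _ yE]]] := graph_div gG n h.
have y0 := graph_neq0 gG h'.
have [u hu] : ran G (y / y').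
  by apply: (torsion (n := n)); rewrite expr_div_n yE divff // -yE expf_neq0.
by exists (u + x'); rewrite -[y](divfK y0); apply: graphD.
Qed.

Lemma ran_psi q : ran G (psi q) -> q = 0.
Proof.
move=> [x h]; apply: contrapT => /eqP q0; apply: ne.
have [n nE] : exists n, `|numq q|%N = n.+1.
  by exists `|numq q|%N.-1; rewrite prednK // absz_gt0 numq_eq0.
apply: (@ran_root n); rewrite -powerMn // -nE.
have E : q *+ `|denq q|%N = 1 *~ numq q.
  rewrite pmulrn absz_denq -mulrzr -{1}[q]divq_num_den divfK //.
  by rewrite intr_eq0 denq_eq0.
have {h} : ran G (psi (1 *~ numq q)).
  by exists (x *+ `|denq q|%N); rewrite -E powerMn //; apply: graphMn.
case: (numq q) => m // [z hz]; exists (- z); rewrite -[X in psi X]opprK powerN //.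
apply: graphN => //; by move: hz; rewrite NegzE.
Qed.

Lemma ext_ker x : ext G d psi (x, 1) -> G (x, 1).
Proof.
move=> [x' [y' [q [h [-> E]]]]].
have q0 : q = 0.
  apply: ran_psi; exists (- x'); have := graphN gG h.
  suff -> : y'^-1 = psi q by [].
  by apply: (mulfI (graph_neq0 gG h)); rewrite -E divff // (graph_neq0 gG h).
move: E; rewrite q0 ratr0_char0 // mul0r addr0 (power0 psiP) mulr1 => ->.
exact: h.
Qed.

End Extend.
End Graphs.

(** * Predimension along the construction *)

Section Strong.
Local Open Scope ring_scope.
Variables (K F : fieldType) (charK : has_char 0 K).
Implicit Types (G B : K * F -> Prop) (X : seq (K * F)).

(** [strong B G] is [delta (X / B) >= 0] for all finite [X] in [G], with the
    negative term moved to the other side. *)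
Definition strong B G : Prop := forall X, (forall z, z \in X -> G z) ->
  (rk (@qspan K) (dom B) (map fst X) <=
   rk (@alg_cl K) (dom B) (map fst X) + rk (@alg_cl F) (ran B) (map snd X))%N.

Lemma alg_cl_sub (L : fieldType) (S S' : L -> Prop) : (forall x, S x -> S' x) ->
  forall x, alg_cl S x -> alg_cl S' x.
Proof. exact: (cl_sub (@alg_cl_pregeometry L)). Qed.

(** If the new pair [(d, psi 1)] has an algebraically new component then it
    adds at least [1] to the algebraic ranks, and exactly [1] to the linear one;
    modulo one element outside [G], every finite subset of the extension moves
    into [G]. *)
Lemma strong_ext B G d psi : exp_graph G -> (forall z, B z -> G z) ->
  power_system psi -> ~ dom G d ->
  ~ alg_cl (dom G) d \/ ~ alg_cl (ran G) (psi 1) ->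
  strong B G -> strong B (ext G d psi).
Proof.
move=> gG BG psiP nd new sG X XG'; set G' := ext G d psi in XG'.
have gG' : exp_graph G' by apply: ext_graph.
have [XG|[z1 [z1X nz1]]] : (forall z, z \in X -> G z) \/ exists z1, z1 \in X /\ ~ G z1.
- have [|no] := EM (exists z1, z1 \in X /\ ~ G z1); first by right.
  by left=> z zX; apply: contrapT => nz; apply: no; exists z.
- exact: sG.
have [x1 [y1 [q1 [h1 z1E]]]] := XG' _ z1X.
have q10 : q1 != 0.
  apply/eqP => q10; apply: nz1; rewrite z1E q10 ratr0_char0 // mul0r addr0.
  by rewrite (power0 psiP) mulr1.
have G'z1 : G' (z1.1, z1.2) by rewrite -surjective_pairing; apply: XG'.
have shift z : exists z', G' z ->
    [/\ G z', exists r : rat, z'.1 = z.1 - ratr r * z1.1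
      & exists2 w, w != 0 /\ alg_cl (fun y => y = z1.2) w & z'.2 = z.2 / w].
  have [[x [y [q [h zE]]]]|no] := EM (G' z); last by exists z.
  have [w hw wy] := graphZ charK gG' (q / q1) G'z1.
  have G'z : G' (z.1, z.2) by rewrite -surjective_pairing; exists x, y, q.
  have hz := graphB gG' G'z hw.
  exists (z.1 - ratr (q / q1) * z1.1, z.2 / w) => _; split; last 2 first.
  - by exists (q / q1).
  - by exists w => //; split=> //; apply: (graph_neq0 gG' hw).
  apply: (ext_old charK gG psiP nd hz).
  have -> : z.1 - ratr (q / q1) * z1.1 = x - ratr (q / q1) * x1.
    rewrite zE z1E /= mulrDr mulrA -ratrM_char0 // divfK // opprD addrACA.
    by rewrite subrr addr0.
  have sd := dom_subspace charK gG.
  by apply: (ssB charK sd); [exists y | apply: (ssZ sd); exists y1].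
have [g gP] := choice shift.
pose X' := map g X.
have X'G z : z \in X' -> G z by case/mapP => w wX ->; have [] := gP _ (XG' _ wX).
have linP := qspan_pregeometry charK.
have algK := alg_cl_pregeometry K; have algF := alg_cl_pregeometry F.
have le1 : (rk (@qspan K) (dom B) (map fst X) <= rk (@qspan K) (dom B) (z1.1 :: map fst X'))%N.
  apply: (rk_le linP) => _ /mapP[z zX ->].
  have [_ [r rE] _] := gP _ (XG' _ zX).
  have ss := qspan_subspace (adj (dom B) (z1.1 :: map fst X')).
  rewrite -[z.1](subrK (ratr r * z1.1)) -rE; apply: (ssD ss); last apply: (ssZ ss).
    by apply: qspan_ext; right; rewrite inE map_f ?orbT // map_f.
  by apply: qspan_ext; right; rewrite mem_head.
have le2 : (rk (@alg_cl K) (dom B) (z1.1 :: map fst X') <= rk (@alg_cl K) (dom B) (map fst X))%N.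
  have sf := alg_cl_subfield (adj (dom B) (map fst X)).
  have inX z : z \in X -> alg_cl (adj (dom B) (map fst X)) z.1.
    by move=> zX; apply: alg_cl_ext; right; apply: map_f.
  apply: (rk_le algK) => y; rewrite inE => /orP[/eqP ->|]; first exact: inX.
  case/mapP => _ /mapP[z zX ->] ->; have [_ [r ->] _] := gP _ (XG' _ zX).
  apply: (sfB sf); first exact: inX.
  by apply: (sfM sf); [apply: (@alg_cl_prime 0) | apply: inX].
have le3 : (rk (@alg_cl F) (ran B) (z1.2 :: map snd X') <= rk (@alg_cl F) (ran B) (map snd X))%N.
  have sf := alg_cl_subfield (adj (ran B) (map snd X)).
  have inX z : z \in X -> alg_cl (adj (ran B) (map snd X)) z.2.
    by move=> zX; apply: alg_cl_ext; right; apply: map_f.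
  apply: (rk_le algF) => y; rewrite inE => /orP[/eqP ->|]; first exact: inX.
  case/mapP => _ /mapP[z zX ->] ->; have [_ _ [w [_ wz] ->]] := gP _ (XG' _ zX).
  apply: (sf_div sf); first exact: inX.
  by apply: (alg_cl_mono _ wz) => _ ->; apply: inX.
have le4 := sG X' X'G.
apply: (leq_trans le1); apply: leq_trans (leq_add le2 le3); rewrite /=.
apply: (@leq_trans (1 + (rk (@alg_cl K) (dom B) (map fst X') +
                         rk (@alg_cl F) (ran B) (map snd X')))%N).
  by rewrite leq_add //; apply: leq_b1.
rewrite addnACA leq_add2r.
suff : ~ alg_cl (adj (dom B) (map fst X')) z1.1 \/ ~ alg_cl (adj (ran B) (map snd X')) z1.2.
  by case=> h; rewrite [in X in (_ <= X)%N](jump1 h) ?leq_addr ?leq_addl.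
have subK y : adj (dom B) (map fst X') y -> dom G y.
  case=> [[v /BG h]|/mapP[[u v] /X'G h ->]]; by exists v.
have subF y : adj (ran B) (map snd X') y -> ran G y.
  case=> [[v /BG h]|/mapP[[u v] /X'G h ->]]; [by exists v | by exists u].
case: new => new; [left | right] => h; apply: new.
  have {h} := alg_cl_sub subK h; rewrite z1E /= => h.
  have sf := alg_cl_subfield (dom G).
  have : alg_cl (dom G) (ratr q1 * d).
    rewrite -[_ * _](addKr x1); apply: (sfD sf) => //; apply: (sfN sf).
    by apply: alg_cl_ext; exists y1.
  have dE : d = ratr q1^-1 * (ratr q1 * d).
    by rewrite ratrV_char0 // mulKf // ratr_eq0_char0.
  by move=> h'; rewrite dE; apply: (sfM sf) => //; apply: (@alg_cl_prime 0).
have {h} := alg_cl_sub subF h; rewrite z1E /= => h.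
have sf := alg_cl_subfield (ran G).
have : alg_cl (ran G) (psi q1).
  rewrite -[psi q1](mulKf (graph_neq0 gG h1)); apply: (sfM sf) => //; apply: (sfV sf).
  by apply: alg_cl_ext; exists x1.
by move/(power_alg psiP q1^-1); rewrite mulVf.
Qed.

End Strong.

(** * The maximal graph *)

Section Completion.
Local Open Scope ring_scope.
Variables (K0 R K F : fieldType) (C : Type) (iota : {rmorphism K0 -> K})
  (j : {rmorphism R -> F}) (charK : has_char 0 K).
Variables (cK : C -> K0) (cR : C -> R) (s e : term C -> K) (t h : term C -> F).
Hypotheses
  (s_free : forall u, ~ alg_cl (base_with iota s (fun v => v <> u)) (s u))
  (t_free : forall u, ~ alg_cl (base_with j t (fun v => v <> u)) (t u))
  (e_onto : forall x, exists u, e u = x) (h_onto : forall y, exists u, h u = y)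
  (e_cst : (forall a, e (Cst a) = iota (cK a)) /\ (forall u, e (Var u) = s u))
  (h_cst : (forall a, h (Cst a) = j (cR a)) /\ (forall u, h (Var u) = t u))
  (e_op : (forall u v, e (Sub u v) = e u - e v) /\ (forall u v, e (Div u v) = e u / e v))
  (h_op : (forall u v, h (Sub u v) = h u - h v) /\ (forall u v, h (Div u v) = h u / h v))
  (e_root : forall n u, e (Root n u) ^+ n.+1 = e u)
  (h_root : forall n u, h (Root n u) ^+ n.+1 = h u).

Variable G0 : K * F -> Prop.
Hypotheses (gG0 : exp_graph G0)
  (dom0 : forall x, dom G0 x -> exists c, iota c = x)
  (ran0 : forall y, ran G0 y -> exists c, j c = y)
  (torsion : forall n (z : F), z ^+ n.+1 = 1 -> ran G0 z)
  (strong0 : strong (fun=> False) G0).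

Implicit Types G : K * F -> Prop.

(** The names whose reserved generic element of [K] (resp. of [F]) may have
    been used: those of elements that are already in the range (resp. domain). *)
Definition usedK G u := h u = 0 \/ ran G (h u).
Definition usedF G u := dom G (e u).

Record good G : Prop := Good {
  good_graph : exp_graph G;
  good_sub : forall z, G0 z -> G z;
  good_ker : forall x, G (x, 1) -> G0 (x, 1);
  good_dom : forall x, dom G x -> alg_cl (base_with iota s (usedK G)) x;
  good_ran : forall y, ran G y -> alg_cl (base_with j t (usedF G)) y;
  good_abs : strong (fun=> False) G;
  good_rel : strong G0 G
}.

Lemma base_with_sub (k L : fieldType) (f : k -> L) (w : term C -> L) (V V' : term C -> Prop) :
  (forall u, V u -> V' u) -> forall x, alg_cl (base_with f w V) x -> alg_cl (base_with f w V') x.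
Proof.
move=> sub; apply: alg_cl_sub => x [?|[u /sub Vu <-]]; first by left.
by right; exists u.
Qed.

Lemma usedK_sub G G' : (forall z, G z -> G' z) -> forall u, usedK G u -> usedK G' u.
Proof. by move=> sub u [?|[x /sub hx]]; [left | right; exists x]. Qed.

Lemma usedF_sub G G' : (forall z, G z -> G' z) -> forall u, usedF G u -> usedF G' u.
Proof. by move=> sub u [x /sub hx]; exists x. Qed.

Lemma good_G0 : good G0.
Proof.
split=> //.
- by move=> x /dom0 xr; apply: alg_cl_ext; left.
- by move=> y /ran0 yr; apply: alg_cl_ext; left.
move=> X XG0; rewrite (rk_eq0 (qspan_pregeometry charK)) // => _ /mapP[[x y] /XG0 xy ->].
by apply: qspan_ext; exists y.
Qed.

Lemma good_union (A : (K * F -> Prop) -> Prop) : (exists G, A G) ->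
  (forall G, A G -> good G) ->
  (forall G G', A G -> A G' -> (forall z, G z -> G' z) \/ (forall z, G' z -> G z)) ->
  good (fun z => exists2 G, A G & G z).
Proof.
move=> [G1 AG1] Agood chain; set U := fun z => _.
have subU G : A G -> forall z, G z -> U z by move=> AG z Gz; exists G.
have two z z' : U z -> U z' -> exists2 G, A G & G z /\ G z'.
  move=> [G AG Gz] [G' AG' Gz'].
  by case: (chain _ _ AG AG') => sub; [exists G' | exists G] => //; split=> //; apply: sub.
have fin (X : seq (K * F)) : (forall z, z \in X -> U z) -> exists2 G, A G & forall z, z \in X -> G z.
  elim: X => [|z X IH] XU; first by exists G1.
  have [|G AG XG] := IH; first by move=> w wX; apply: XU; rewrite inE wX orbT.
  have [G' AG' G'z] := XU z (mem_head _ _).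
  case: (chain _ _ AG AG') => sub.
    by exists G' => // w; rewrite inE => /orP[/eqP -> //|/XG/sub].
  by exists G => // w; rewrite inE => /orP[/eqP ->|/XG//]; apply: sub.
have strongU B : (forall G, A G -> strong B G) -> strong B U.
  by move=> hB X /fin[G AG XG]; apply: (hB G AG).
split.
- split.
  + by exists G1 => //; apply: (graph1 (good_graph (Agood _ AG1))).
  + move=> x y x' y' hz hz'; have [G AG [Gz Gz']] := two _ _ hz hz'.
    by exists G => //; apply: (graphB (good_graph (Agood _ AG))).
  + by move=> x y [G AG Gz]; apply: (graph_neq0 (good_graph (Agood _ AG)) Gz).
  + move=> n x y [G AG Gz].
    have [x' [y' [Gz' xE yE]]] := graph_div (good_graph (Agood _ AG)) n Gz.
    by exists x', y'; split=> //; exists G.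
  + by move=> y [G AG Gz]; apply: (graph_fun (good_graph (Agood _ AG)) Gz).
- by move=> z /(good_sub (Agood _ AG1)) G1z; exists G1.
- by move=> x [G AG Gz]; apply: (good_ker (Agood _ AG) Gz).
- move=> x [y [G AG Gz]]; apply: (base_with_sub (usedK_sub (subU _ AG))).
  by apply: (good_dom (Agood _ AG)); exists y.
- move=> y [x [G AG Gz]]; apply: (base_with_sub (usedF_sub (subU _ AG))).
  by apply: (good_ran (Agood _ AG)); exists x.
- by apply: strongU => G /Agood/good_abs.
- by apply: strongU => G /Agood/good_rel.
Qed.

Lemma F_roots n (y : F) : exists z, z ^+ n.+1 = y.
Proof. by have [u <-] := h_onto y; exists (h (Root n u)). Qed.

(** The roots of unity in the range protect the kernel, and the algebraically new
    component of the pair protects the rank inequalities. *)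
Lemma good_step G d psi : good G -> power_system psi ->
  ~ dom G d -> ~ ran G (psi 1) ->
  ~ alg_cl (dom G) d \/ ~ alg_cl (ran G) (psi 1) ->
  alg_cl (base_with iota s (usedK (ext G d psi))) d ->
  alg_cl (base_with j t (usedF (ext G d psi))) (psi 1) ->
  good (ext G d psi).
Proof.
move=> [gG GG0 kG dG rG aG lG] psiP nd nr new cd cr.
have sub := @ext_sub _ _ charK G d _ psiP.
have tors n (z : F) : z ^+ n.+1 = 1 -> ran G z.
  by move=> /torsion[x /GG0 hx]; exists x.
split.
- exact: ext_graph.
- by move=> z /GG0; apply: sub.
- by move=> x /(ext_ker charK gG psiP nr tors)/kG.
- move=> _ [_ [x [y [q [hz [-> _]]]]]].
  have sf := alg_cl_subfield (base_with iota s (usedK (ext G d psi))).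
  apply: (sfD sf); last by apply: (sfM sf) => //; apply: (@alg_cl_prime 0).
  by apply: (base_with_sub (usedK_sub sub)); apply: dG; exists y.
- move=> _ [_ [x [y [q [hz [_ ->]]]]]].
  have sf := alg_cl_subfield (base_with j t (usedF (ext G d psi))).
  apply: (sfM sf); last by rewrite -[q]mulr1; apply: power_alg.
  by apply: (base_with_sub (usedF_sub sub)); apply: rG; exists x.
- by apply: strong_ext.
- by apply: strong_ext.
Qed.

(** If [e u] is outside the domain then [t u] is transcendental over the range and
    the pair [(e u, t u)] may be added, provided that [e u] is algebraic over the
    transcendentals of the used names.  Induction on [u] establishes this proviso,
    for both fields simultaneously. *)
Lemma complete_graph : exists G, [/\ good G, forall x, dom G x & forall y, y != 0 -> ran G y].
Proof.
have [||G gG maxG] := @zorn_union _ good.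
- by exists G0; apply: good_G0.
- exact: good_union.
have gr := good_graph gG; exists G.
have maxdom d psi : power_system psi -> good (ext G d psi) -> dom G d /\ ran G (psi 1).
  move=> psiP good'; have h1 : G (d, psi 1).
    by apply: (maxG _ good' (@ext_sub _ _ charK G d _ psiP)); apply: ext_new.
  by split; [exists (psi 1) | exists d].
have in_dom x : alg_cl (base_with iota s (usedK G)) x -> dom G x.
  move=> cx; apply: contrapT => nd; have [u ux] := e_onto x.
  have new : ~ alg_cl (ran G) (t u).
    move=> cl; apply: (t_free (u := u)); apply: (alg_cl_mono _ cl) => y /(good_ran gG).
    by apply: base_with_sub => v vG vu; apply: nd; rewrite -ux -vu.
  have t0 : t u != 0 by apply/eqP => E; apply: new; rewrite E; exact: (sf0 (alg_cl_subfield _)).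
  have [psi psiP psi1] := power_system_through t0 F_roots.
  have sub := @ext_sub _ _ charK G x _ psiP.
  have [] // := maxdom x psi psiP; apply: good_step => //; rewrite ?psi1.
  + by move=> r; apply: new; apply: alg_cl_ext.
  + by right.
  + by apply: (base_with_sub (usedK_sub sub)).
  apply: alg_cl_ext; right; exists u => //; rewrite /usedF ux.
  by exists (psi 1); apply: ext_new.
have in_ran y : alg_cl (base_with j t (usedF G)) y -> y = 0 \/ ran G y.
  move=> cy; apply: contrapT => nor.
  have [y0|y0] := eqVneq y 0; first by apply: nor; left.
  have nr : ~ ran G y by move=> r; apply: nor; right.
  have [u uy] := h_onto y.
  have new : ~ alg_cl (dom G) (s u).
    move=> cl; apply: (s_free (u := u)); apply: (alg_cl_mono _ cl) => x /(good_dom gG).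
    by apply: base_with_sub => v vG vu; apply: nor; rewrite -uy -vu.
  have [psi psiP psi1] := power_system_through y0 F_roots.
  have sub := @ext_sub _ _ charK G (s u) _ psiP.
  have [|_] := maxdom (s u) psi psiP.
    apply: good_step => //; rewrite ?psi1 //.
    + by move=> r; apply: new; apply: alg_cl_ext.
    + by left.
    + apply: alg_cl_ext; right; exists u => //; right; rewrite uy -psi1.
      by exists (s u); apply: ext_new.
    by apply: (base_with_sub (usedF_sub sub)).
  by rewrite psi1.
have all u : alg_cl (base_with iota s (usedK G)) (e u) /\ alg_cl (base_with j t (usedF G)) (h u).
  have sfK := alg_cl_subfield (base_with iota s (usedK G)).
  have sfF := alg_cl_subfield (base_with j t (usedF G)).
  elim: u => [a|u [/in_dom eu /in_ran hu]|u [eu hu] v [ev hv]|u [eu hu] v [ev hv]|n u [eu hu]].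
  - rewrite e_cst.1 h_cst.1; split; apply: alg_cl_ext; left; [by exists (cK a)|by exists (cR a)].
  - by rewrite e_cst.2 h_cst.2; split; apply: alg_cl_ext; right; exists u.
  - by rewrite e_op.1 h_op.1; split; [apply: (sfB sfK) | apply: (sfB sfF)].
  - by rewrite e_op.2 h_op.2; split; [apply: (sf_div sfK) | apply: (sf_div sfF)].
  - by split; apply: (@alg_cl_root _ _ _ n); rewrite ?e_root ?h_root.
split=> // [x|y y0]; first by have [u <-] := e_onto x; apply: in_dom (all u).1.
have [u uy] := h_onto y; case: (in_ran _ (all u).2) => [E|]; last by rewrite uy.
by rewrite -uy E eqxx in y0.
Qed.

End Completion.

(** * Roots of unity and the full kernel *)

Section RootsOfUnity.
Local Open Scope ring_scope.

Lemma natr_eq0_same_char (p : nat) (K L : fieldType) n :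
  has_char p K -> has_char p L -> (n%:R == 0 :> K) = (n%:R == 0 :> L).
Proof.
case: p => [|p] cK cL; first by rewrite !natr_eq0_char0.
by rewrite -(dvdn_pcharf cK) -(dvdn_pcharf cL).
Qed.

Lemma closed_prim_root (F : closedFieldType) n : n.+1%:R != 0 :> F ->
  exists w : F, n.+1.-primitive_root w.
Proof.
pose q : {poly F} := 'X^(n.+1) - 1; have [r Dq] := closed_field_poly_normal q.
move=> n0; rewrite (monicP _) ?monicXnsubC // scale1r in Dq.
have rn1: all n.+1.-unity_root r by apply/allP=> z; rewrite -root_prod_XsubC -Dq.
have sz_r: (n.+1 < (size r).+1)%N.
  by rewrite -(size_prod_XsubC r id) -Dq size_XnsubC.
have [|z] := hasP (has_prim_root (ltn0Sn n) rn1 _ sz_r); last by exists z.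
by rewrite -separable_prod_XsubC -Dq separable_Xn_sub_1.
Qed.

Section Hom.
Variables (L : zmodType) (F : fieldType) (A : zmodClosed L) (f : L -> F).
Hypotheses (f0 : forall x, x \in A -> f x != 0)
  (fD : forall x y, x \in A -> y \in A -> f (x + y) = f x * f y).

Lemma hom0 : f 0 = 1.
Proof.
have A0 : 0 \in A := rpred0 A; apply: (mulfI (f0 A0)).
by rewrite -fD // addr0 mulr1.
Qed.

Lemma homB x y : x \in A -> y \in A -> f (x - y) = f x / f y.
Proof.
move=> Ax Ay; apply: (mulIf (f0 Ay)); rewrite -fD ?rpredB //.
by rewrite subrK divfK // f0.
Qed.

Lemma homMn x n : x \in A -> f (x *+ n) = f x ^+ n.
Proof.
move=> Ax; elim: n => [|n IH]; first exact: hom0.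
by rewrite mulrS exprS fD ?IH // rpredMn.
Qed.
End Hom.

(** For [n] invertible in [F], a primitive root of unity of the closed field is
    the image of some [a] in [A], and [expo a], having the same order, is
    primitive as well; for [n] the characteristic, [z ^ n = 1] forces
    [z = 1]. *)
Lemma torsion_in_image (p : nat) (A : subE p) (F : fieldType) (j : {rmorphism rfield A -> F}) :
  full_kernel A -> forall n (z : F), z ^+ n.+1 = 1 ->
  exists2 a, a \in carrier A & j (expo a) = z.
Proof.
move=> [M [g [cM g0 graphD gker gtors]]].
have cF : has_char p F := has_char_morph j (rfield_char A).
have eMn a m : a \in carrier A -> expo (a *+ m) = expo a ^+ m.
  exact: (homMn (@expo_neq0 _ A) (@expoD _ A)).
have graphMn a m : a \in carrier A -> g (a *+ m) = g a ^+ m := homMn g0 graphD m.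
elim/ltn_ind => n IH z zn; have [n0|nz] := eqVneq (n.+1%:R : F) 0.
  case: p => [|p] in A j M g cM g0 graphD gker gtors cF eMn graphMn IH n0 *.
    by move/eqP: n0; rewrite natr_eq0_char0.
  have pp : prime p.+1 := pcharf_prime cF.
  have /dvdnP[[//|m] nE] : (p.+1 %| n.+1)%N by rewrite (dvdn_pcharf cF) n0.
  apply: (IH m).
    have := prime_gt1 pp; rewrite ltnS => p1.
    by rewrite -ltnS nE ltn_Pmulr.
  have : pFrobenius_aut cF (z ^+ m.+1 - 1) = 0.
    by rewrite rmorphB rmorph1 /= pFrobenius_autE -exprM -nE zn subrr.
  by move/eqP; rewrite fmorph_eq0 subr_eq0 => /eqP.
have [|w wP] := @closed_prim_root M n; first by rewrite (natr_eq0_same_char _ cM cF).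
have [a Aa ga] := gtors w n (prim_expr_order wP).
have order m : expo a ^+ m = 1 <-> w ^+ m = 1.
  have Am : a *+ m \in carrier A by rewrite rpredMn.
  rewrite -ga -graphMn // -eMn //; split=> [E|/(gker _ Am)[]//].
  by apply/(gker _ Am).
have en : expo a ^+ n.+1 = 1 by apply/order/prim_expr_order.
have jn : j (expo a) ^+ n.+1 = 1 by rewrite -rmorphXn en rmorph1.
have [m jP mn] := prim_order_exists (ltn0Sn n) jn.
have mE : m = n.+1.
  apply/eqP; rewrite eqn_dvd mn (prim_order_dvd wP); apply/eqP/order.
  by apply: (fmorph_inj j); rewrite rmorphXn rmorph1 (prim_expr_order jP).
rewrite mE in jP; have [i ->] := prim_rootP jP zn.
by exists (a *+ i); rewrite ?rpredMn // eMn // rmorphXn.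
Qed.

End RootsOfUnity.

(** * The exponential field and its verification *)

Section Main.
Local Open Scope ring_scope.

(** All of [K], as a predicate of which closedness can be inferred. *)
Definition whole (K : zmodType) : {pred K} := fun=> true.
Lemma whole_closed (K : zmodType) : zmod_closed (@whole K). Proof. by []. Qed.
HB.instance Definition _ (K : zmodType) :=
  GRing.isZmodClosed.Build K (@whole K) (@whole_closed K).

Definition base_graph (p : nat) (A : subE p) (K F : fieldType)
    (iota : dfield A -> K) (j : rfield A -> F) (z : K * F) : Prop :=
  exists2 a, a \in carrier A & z = (iota a, j (expo a)).

Section Base.
Variables (p : nat) (A : subE p) (K F : fieldType).
Variables (iota : {rmorphism dfield A -> K}) (j : {rmorphism rfield A -> F}).
Let G0 := base_graph iota j.

Lemma base_exp_graph : exp_graph G0.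
Proof.
have e0 := @expo_neq0 _ A; have eD := @expoD _ A.
split.
- by exists 0; rewrite ?rpred0 // rmorph0 (hom0 e0 eD) rmorph1.
- move=> _ _ _ _ [a Aa [-> ->]] [b Ab [-> ->]]; exists (a - b); first exact: rpredB.
  by rewrite rmorphB (homB e0 eD) // fmorph_div.
- by move=> _ _ [a Aa [_ ->]]; rewrite fmorph_eq0 e0.
- move=> n _ _ [a Aa [-> ->]]; have [b Ab <-] := carrier_div n Aa.
  exists (iota b), (j (expo b)); rewrite (homMn e0 eD) // rmorphXn rmorphMn.
  by split=> //; exists b.
- move=> y [a Aa [/esym/eqP]]; rewrite fmorph_eq0 => /eqP -> ->.
  by rewrite (hom0 e0 eD) rmorph1.
Qed.

Lemma base_strong : in_subS A -> strong (fun=> False) G0.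
Proof.
move=> hS X XG0.
have [Y [YA ->]] : exists Y : seq (dfield A), {subset Y <= carrier A} /\
    X = [seq (iota a, j (expo a)) | a <- Y].
  elim: X XG0 => [|z X IH] XG0; first by exists [::].
  have [|Y [YA ->]] := IH; first by move=> w wX; apply: XG0; rewrite inE wX orbT.
  have [a Aa ->] := XG0 z (mem_head _ _); exists (a :: Y); split=> // b.
  by rewrite inE => /orP[/eqP ->|/YA].
have cK := has_char_morph iota (dfield_char A).
have := hS Y YA; rewrite /delta (trdegE _ (dfield_char A)) (trdegE _ (rfield_char A)).
rewrite (dimQE (dfield_char A)) Num.Theory.subr_ge0 -PoszD lez_nat => le.
have dom_none x : dom (fun _ : K * F => False) x <-> False by split=> // -[].
have ran_none y : ran (fun _ : K * F => False) y <-> False by split=> // -[].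
rewrite !(rk_eq (qspan_pregeometry cK) _ dom_none).
rewrite !(rk_eq (alg_cl_pregeometry K) _ dom_none).
rewrite !(rk_eq (alg_cl_pregeometry F) _ ran_none) -!map_comp.
have -> : map (fst \o (fun a => (iota a, j (expo a)))) Y = map iota Y by [].
have -> : map (snd \o (fun a => (iota a, j (expo a)))) Y = map j (map (@expo _ A) Y).
  by rewrite -map_comp.
apply: leq_trans (rk_span_map iota _ (dfield_char A)) _; apply: (leq_trans le).
rewrite leq_add //; first exact: (rk_alg_map iota _ (dfield_char A)).
exact: (rk_alg_map j _ (rfield_char A)).
Qed.
End Base.

Section Structure.
Variables (p : nat) (K F : fieldType) (cK : has_char 0 K) (cF : has_char p F).
Variables (ex : K -> F) (ex0 : forall x, ex x != 0) (exD : forall x y, ex (x + y) = ex x * ex y).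

Lemma whole_div (n : nat) (x : K) : x \in @whole K ->
  exists2 y : K, y \in @whole K & y *+ n.+1 = x.
Proof.
move=> _; exists (x / n.+1%:R) => //; rewrite -[LHS]mulr_natr divfK //.
by rewrite natr_eq0_char0.
Qed.

Definition exp_structure : subE p :=
  @SubE p K cK F cF (@whole K) whole_div ex (fun x _ => ex0 x) (fun x y _ _ => exD x y).

Variable G : K * F -> Prop.
Hypothesis (Gex : forall x, G (x, ex x)).

Lemma map_snd_graph X : map snd (map (fun x => (x, ex x)) X) = map ex X.
Proof. by rewrite -map_comp. Qed.

Lemma map_fst_graph X : map fst (map (fun x => (x, ex x)) X) = X.
Proof. by rewrite -map_comp map_id. Qed.

Lemma strong_seq B X : strong B G ->
  (rk (@qspan K) (dom B) X <= rk (@alg_cl K) (dom B) X + rk (@alg_cl F) (ran B) (map ex X))%N.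
Proof.
move=> /(_ (map (fun x => (x, ex x)) X)); rewrite map_snd_graph map_fst_graph.
by apply=> _ /mapP[x _ ->].
Qed.

Lemma deltaE (X : seq K) : delta (A := exp_structure) X =
  (rk (@alg_cl K) (fun=> False) X)%:Z + (rk (@alg_cl F) (fun=> False) (map ex X))%:Z
  - (rk (@qspan K) (fun=> False) X)%:Z.
Proof. by rewrite /delta (trdegE _ cK) (trdegE _ cF) (dimQE cK). Qed.

Lemma exp_structure_subS : strong (fun=> False) G -> in_subS exp_structure.
Proof.
move=> sG X _; rewrite deltaE Num.Theory.subr_ge0 -PoszD lez_nat.
have := strong_seq X sG.
have dom_none x : dom (fun _ : K * F => False) x <-> False by split=> // -[].
have ran_none y : ran (fun _ : K * F => False) y <-> False by split=> // -[].
rewrite (rk_eq (qspan_pregeometry cK) _ dom_none).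
by rewrite (rk_eq (alg_cl_pregeometry K) _ dom_none) (rk_eq (alg_cl_pregeometry F) _ ran_none).
Qed.

(** Enlarging [Y] by finitely many elements of the base, the linear dimension of
    [X] over it becomes its dimension over the whole base, while the transcendence
    degrees over a subset of the base can only be larger. *)
Lemma delta_over_base (B : K * F -> Prop) X : (forall z, B z -> G z) ->
  (forall x y, G (x, y) -> y = ex x) -> strong B G ->
  delta_over_ge (A := exp_structure) X (dom B) 0.
Proof.
move=> BG Gfun sG Y YB.
have [Z ZB le] := rk_fin (qspan_pregeometry cK) (dom B) X.
exists (Y ++ Z); split=> [y yY|y|].
- by rewrite mem_cat yY.
- by rewrite mem_cat => /orP[/YB|/ZB].
have YZB y : y \in Y ++ Z -> dom B y by rewrite mem_cat => /orP[/YB|/ZB].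
rewrite /delta_over !deltaE map_cat.
rewrite !(rk_cat (alg_cl_pregeometry K)) !(rk_cat (alg_cl_pregeometry F)) !(rk_cat (qspan_pregeometry cK)).
have le1 := strong_seq X sG.
have le2 : (rk (@alg_cl K) (dom B) X <= rk (@alg_cl K) (adj (fun=> False) (Y ++ Z)) X)%N.
  by apply: (rk_base_le (alg_cl_pregeometry K)) => x [//|/YZB xB]; apply: alg_cl_ext.
have le3 : (rk (@alg_cl F) (ran B) (map ex X) <=
    rk (@alg_cl F) (adj (fun=> False) (map ex (Y ++ Z))) (map ex X))%N.
  apply: (rk_base_le (alg_cl_pregeometry F)) => y [//|/mapP[x /YZB[y' By'] ->]].
  by apply: alg_cl_ext; exists x; rewrite -(Gfun _ _ (BG _ By')).
have le4 : (rk (@qspan K) (adj (fun=> False) (Y ++ Z)) X <= rk (@qspan K) (dom B) X)%N.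
  apply: leq_trans le; apply: (rk_base_le (qspan_pregeometry cK)) => x xZ.
  by apply: qspan_ext; right; rewrite mem_cat xZ orbT.
have := leq_trans le4 (leq_trans le1 (leq_add le2 le3)).
rewrite map_cat.
move: (rk _ _ X) (rk _ _ X) (rk _ _ (map ex X)) => a b c.
lia.
Qed.

End Structure.

Lemma on_variety_map (p n : nat) (L M : fieldType) (f : {rmorphism L -> M})
    (V : variety_over_prime p n) (x : 'I_n -> L) :
  on_variety V x <-> on_variety V (fun i => f (x i)).
Proof.
have E g : prime_eval (fun i => f (x i)) g = f (prime_eval x g).
  rewrite /prime_eval rmorph_mmap; apply: eq_mmap => // c /=.
  exact/esym/prime_emb_map.
by split=> h g gV; [rewrite E (h g gV) rmorph0 | apply: (fmorph_inj f); rewrite -E (h g gV) rmorph0].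
Qed.

End Main.

Theorem lemma2p8 (p : nat) (hp : p = 0 \/ prime p) (A : subE p)
    (hS : in_subS A) (hker : full_kernel A) :
  exists (D : subE p) (f : dfield A -> dfield D),
    [/\ in_S D, strong_embedding f & same_kernel f].
Proof.
pose cK (c : dfield A + rfield A) : dfield A := if c is inl a then a else 0%R.
pose cR (c : dfield A + rfield A) : rfield A := if c is inr b then b else 0%R.
have [|K [iota [s [e [s_free e_onto e_cst e_op e_root]]]]] := @term_field _ _ cK.
  by move=> a; exists (inl a).
have [|F [j [t [h [t_free h_onto h_cst h_op h_root]]]]] := @term_field _ _ cR.
  by move=> b; exists (inr b).
have charK : has_char 0 K := has_char_morph iota (dfield_char A).
have charF : has_char p F := has_char_morph j (rfield_char A).
have [|||||G [[gG G0G Gker _ _ G_abs G_rel] domG ranG]] :=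
  @complete_graph _ _ _ _ _ iota j charK cK cR s e t h s_free t_free e_onto h_onto
    e_cst h_cst e_op h_op e_root h_root (base_graph iota j).
- exact: base_exp_graph.
- by move=> x [y [a _ [-> _]]]; exists a.
- by move=> y [x [a _ [_ ->]]]; exists (expo a).
- by move=> n z /(torsion_in_image j hker)[a Aa <-]; exists (iota a), a.
- exact: base_strong.
have [ex Gex] := choice domG.
have Gfun x y : G (x, y) -> y = ex x by move=> Gxy; apply: (graph_functional gG Gxy (Gex x)).
have ex0 x : ex x != 0%R := graph_neq0 gG (Gex x).
have exD x y : ex (x + y)%R = (ex x * ex y)%R.
  by apply/esym/Gfun; apply: graphD.
have exA a : a \in carrier A -> ex (iota a) = j (expo a).
  by move=> Aa; apply/esym/Gfun/G0G; exists a.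
exists (exp_structure charK charF ex0 exD), iota; split.
- split; last exact: (exp_structure_subS (G := G)).
  split=> // r r0; have [x /Gfun ->] := ranG r r0; by exists x.
- split; first split.
  + split=> //.
    * by move=> x y _ _ /fmorph_inj.
    * by move=> x y _ _; rewrite rmorphD.
    * by move=> q x _; rewrite rmorphM; congr (_ * _)%R; apply: (@prime_emb_map 0).
  + by move=> n V x _; apply: on_variety_map.
  + move=> n W x Ax; have E : (fun i => ex (iota (x i))) = (fun i => j (expo (x i))).
      by apply/funext => i; apply: exA.
    rewrite -[X in _ <-> X]/(on_variety W (fun i => ex (iota (x i)))) E.
    exact: on_variety_map.
  + move=> X _ Y Yim.
    have [|Y' [YY' Y'dom le]] := @delta_over_base p K F charK charF ex ex0 exD G Gex _ X G0G Gfun G_rel Y.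
      by move=> y /Yim[a Aa <-]; exists (j (expo a)), a.
    exists Y'; split=> // y /Y'dom[_ [a Aa [-> _]]]; by exists a.
- move=> y; split=> [[_ E]|[x [Ax ex1] <-]].
    have /Gker[a Aa [ya ja]] : G (y, 1%R) by rewrite -E; apply: Gex.
    exists a => //; split=> //; apply: (fmorph_inj j); by rewrite rmorph1.
  split=> //; rewrite -[LHS]/(ex (iota x)) exA // ex1; exact: rmorph1.
Qed.
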